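(* Let $R$ be a Dedekind domain and $n\ge0$. There is a homotopy equivalence in $\mathrm{Sset}_{[1]}$ $$\mathtt K(R,n,[1],\overline\infty)\simeq\Delta[0]*K(R,n),$$ where $\overline\infty$ is the perversity on $[1]=\{0<1\}$ with value $\infty$ at $0$, and $\Delta[0]*K(R,n)$ is the join, viewed over $\Delta[1]=\Delta[0]*\Delta[0]$ through the join of the maps $\Delta[0]\to\Delta[0]$ and $K(R,n)\to\Delta[0]$.
   Context: **Simplicial sets over $[1]$.** $N([1])=\Delta[1]$, and $\mathrm{Sset}_{[1]}$ is the category of simplicial maps $\Psi_K\colon K\to\Delta[1]$ with simplicial maps over $\Delta[1]$, equivalently of presheaves on the category of simplices of $\Delta[1]$. For a simplicial set $L$, $\Psi_K\otimes L$ is $K\times L\to K\to\Delta[1]$; $\mathrm{Hom}^\Delta(\Psi_K,\Psi_{K'})$ has $k$-simplices $\mathrm{Hom}(\Psi_K\otimes\Delta[k],\Psi_{K'})$; two morphisms are homotopic if they are in the same class of $\pi_0\mathrm{Hom}^\Delta$; a homotopy equivalence is a morphism with an inverse up to homotopy in this sense. **Join.** For simplicial sets $A,B$, a $k$-simplex of $A*B$ is a $k$-simplex of $A$, a $k$-simplex of $B$, or a pair $(\sigma,\tau)$ with $\sigma\in A_i$, $\tau\in B_j$, $i+j+1=k$. **Blown-up cochains for $\overline\infty$.** $N^*(-)$ denotes normalized simplicial cochains with coefficients in $R$. A simplex of $N([1])$ is $\Delta[a]*\Delta[b]$ with $a,b\ge-1$ not both $-1$ ($a+1$ vertices over $0$,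 $b+1$ vertices over $1$; $-1$ means empty). It is regular if $b\ge0$. Let $c\Delta[a]$ be the cone with apex $v$ as last vertex, $c\emptyset=\{v\}$. For general perversities $\bar p$ one imposes a condition on cochains in terms of $\bar p(0)$; for $\bar p=\overline\infty$ this condition is empty, and $\widetilde N^*_{\overline\infty}(\Delta[a]*\Delta[b])=N^*(c\Delta[a])\otimes N^*(\Delta[b])$ for regular simplices (equal to $N^*(\Delta[b])$ if $a=-1$), and $0$ on non-regular simplices. With restriction along maps of simplices over $\Delta[1]$ (for a simplex with no vertex over $0$, via the restriction $N^*(c\Delta[a])\to N^*(\{v\})=R$), this is a presheaf on the simplices of $\Delta[1]$. **Eilenberg–MacLane spaces.** $\mathtt K(R,n,[1],\overline\infty)\in\mathrm{Sset}_{[1]}$ is the presheaf $\sigma\mapsto\mathcal Z^n\widetilde N^*_{\overline\infty}(\sigma)$ (degree $n$ cocycles). The classical $K(R,n)$ is the simplicial set with $k$-simplices $\mathcal Z^nN^*(\Delta[k];R)$. *)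

(* Defs.v *)
From HB Require Import structures.
From Stdlib Require Import Relations.Relation_Operators.
From mathcomp Require Import all_boot all_order all_algebra.
From mathcomp Require Import zify.
From mathcomp Require Import boolp functions.

Set Implicit Arguments.
Unset Strict Implicit.
Unset Printing Implicit Defensive.

Import GRing.Theory.

Section Dedekind.
Local Open Scope ring_scope.

(* [idealr_closed] describes the proper ideals, so the improper ideal, which is
   generated by 1, is not mentioned. *)
Definition noetherian (R : idomainType) : Prop :=
  forall I : {pred R}, idealr_closed I ->
  exists s : seq R, forall x : R,
    x \in I <-> exists c : nat -> R, x = \sum_(i < size s) c i * s`_i.

Definition integrally_closed (R : idomainType) : Prop :=
  forall z : {fraction R}, integralOver (@tofrac R) z ->
  exists r : R, z = tofrac r.

Definition maximal_ideal (R : idomainType) (I : {pred R}) : Prop :=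
  idealr_closed I /\
  forall J : {pred R}, idealr_closed J -> {subset I <= J} -> I =i J.

Definition nonzero_primes_maximal (R : idomainType) : Prop :=
  forall P : {pred R}, idealr_closed P -> prime_idealr_closed P ->
  (exists2 x, x \in P & x != 0) -> maximal_ideal P.

(* Fields are allowed. *)
Definition dedekind_domain (R : idomainType) : Prop :=
  [/\ noetherian R, integrally_closed R & nonzero_primes_maximal R].

End Dedekind.

Definition monotone m n (f : {ffun 'I_m.+1 -> 'I_n.+1}) : bool :=
  [forall i : 'I_m.+1, forall j : 'I_m.+1, (i <= j) ==> (f i <= f j)].

(* Monotone maps [m] -> [n]; the vertices of [n] form 'I_n.+1. *)
Record mono m n := Mono {
  mono_ffun :> {ffun 'I_m.+1 -> 'I_n.+1};
  mono_proof : monotone mono_ffun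
}.
HB.instance Definition _ m n := [isSub for @mono_ffun m n].
HB.instance Definition _ m n := [Equality of mono m n by <:].

Lemma monoP m n (f : mono m n) (i j : 'I_m.+1) : i <= j -> f i <= f j.
Proof. by move: (mono_proof f) => /forallP/(_ i)/forallP/(_ j)/implyP. Qed.

Lemma mono_eq m n (f g : mono m n) : (forall i, f i = g i :> nat) -> f = g.
Proof. by move=> fg; apply/val_inj/ffunP => i; apply/val_inj/fg. Qed.

Lemma mk_mono_proof m n (f : 'I_m.+1 -> 'I_n.+1)
  (hf : forall i j : 'I_m.+1, i <= j -> f i <= f j) :
  monotone (finfun f).
Proof.
by apply/forallP => i; apply/forallP => j; apply/implyP => /hf; rewrite !ffunE.
Qed.

Definition mk_mono m n (f : 'I_m.+1 -> 'I_n.+1)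
  (hf : forall i j : 'I_m.+1, i <= j -> f i <= f j) : mono m n :=
  Mono (mk_mono_proof hf).

Lemma mk_monoE m n f hf i : @mk_mono m n f hf i = f i.
Proof. by rewrite /= ffunE. Qed.

Definition mono_id n : mono n n := @mk_mono n n id (fun _ _ => id).

Lemma mono_comp_proof l m n (f : mono m n) (g : mono l m) (i j : 'I_l.+1) :
  i <= j -> f (g i) <= f (g j).
Proof. by move=> ij; do 2!apply: monoP. Qed.

Definition mono_comp l m n (f : mono m n) (g : mono l m) : mono l n :=
  mk_mono (@mono_comp_proof l m n f g).

Lemma mono_idE n i : mono_id n i = i.
Proof. exact: mk_monoE. Qed.

Lemma mono_compE l m n (f : mono m n) (g : mono l m) i :
  mono_comp f g i = f (g i).
Proof. exact: mk_monoE. Qed.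

Lemma mono_comp1 m n (f : mono m n) : mono_comp f (mono_id m) = f.
Proof. by apply: mono_eq => i; rewrite mono_compE mono_idE. Qed.

Lemma mono_1comp m n (f : mono m n) : mono_comp (mono_id n) f = f.
Proof. by apply: mono_eq => i; rewrite mono_compE mono_idE. Qed.

Lemma mono_compA k l m n (f : mono m n) (g : mono l m) (h : mono k l) :
  mono_comp f (mono_comp g h) = mono_comp (mono_comp f g) h.
Proof. by apply: mono_eq => i; rewrite !mono_compE. Qed.

Lemma coface_proof n (j : 'I_n.+2) (u v : 'I_n.+1) :
  u <= v -> lift j u <= lift j v.
Proof. by rewrite /= leq_bump2. Qed.

Definition coface n (j : 'I_n.+2) : mono n n.+1 := mk_mono (@coface_proof n j).

Lemma codegen_bound n (j : 'I_n.+1) (v : 'I_n.+2) : unbump j v < n.+1.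
Proof. by rewrite /unbump; have := ltn_ord v; have := ltn_ord j; lia. Qed.

Lemma codegen_proof n (j : 'I_n.+1) (u v : 'I_n.+2) : u <= v ->
  Ordinal (codegen_bound j u) <= Ordinal (codegen_bound j v).
Proof. by rewrite /= /unbump; lia. Qed.

Definition codegen n (j : 'I_n.+1) : mono n.+1 n :=
  mk_mono (@codegen_proof n j).

Lemma cofaceE n (j : 'I_n.+2) v : coface j v = bump j v :> nat.
Proof. by rewrite mk_monoE. Qed.

Lemma codegenE n (j : 'I_n.+1) v : codegen j v = unbump j v :> nat.
Proof. by rewrite mk_monoE. Qed.

Record sset := Sset {
  obj :> nat -> Type;
  act : forall l k, mono l k -> obj k -> obj l;
  act_id : forall k (x : obj k), act (mono_id k) x = x;
  act_comp : forall k l m (f : mono l k) (g : mono m l) (x : obj k),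
    act (mono_comp f g) x = act g (act f x)
}.
Arguments act s {l k} f x.
Arguments act_id s {k} x.
Arguments act_comp s {k l m} f g x.

Record smap (K L : sset) := Smap {
  app :> forall k, K k -> L k;
  app_act : forall l k (f : mono l k) (x : K k), app (act K f x) = act L f (app x)
}.
Arguments app {K L} s k x.

Lemma smap_eq K L (f g : smap K L) : (forall k x, f k x = g k x) -> f = g.
Proof.
case: f g => [f hf] [g hg] /= fg.
have e : f = g by apply: functional_extensionality_dep => k; apply/funext/fg.
by case: _ / e in hg *; rewrite (Prop_irrelevance hf hg).
Qed.

Definition smap_id K : smap K K :=
  @Smap K K (fun _ x => x) (fun _ _ _ _ => erefl).

Lemma smap_comp_act K L M (g : smap L M) (f : smap K L) l k (a : mono l k) x :
  g l (f l (act K a x)) = act M a (g k (f k x)).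
Proof. by rewrite !app_act. Qed.

Definition smap_comp K L M (g : smap L M) (f : smap K L) : smap K M :=
  @Smap K M (fun k x => g k (f k x)) (smap_comp_act g f).

Definition simplex (n : nat) : sset :=
  @Sset (fun k => mono k n) (fun l k f x => mono_comp x f)
    (fun k x => mono_comp1 x) (fun k l m f g x => mono_compA x f g).

Definition simplex_map m n (f : mono m n) : smap (simplex m) (simplex n) :=
  @Smap (simplex m) (simplex n) (fun k x => mono_comp f x)
    (fun l k g x => mono_compA f x g).

Section Product.
Variables K L : sset.

Definition sprod_obj k := (K k * L k)%type.
Definition sprod_act l k (f : mono l k) (x : sprod_obj k) : sprod_obj l :=
  (act K f x.1, act L f x.2).

Lemma sprod_act_id k (x : sprod_obj k) : sprod_act (mono_id k) x = x.
Proof. by case: x => x y; rewrite /sprod_act !act_id. Qed.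

Lemma sprod_act_comp k l m (f : mono l k) (g : mono m l) (x : sprod_obj k) :
  sprod_act (mono_comp f g) x = sprod_act g (sprod_act f x).
Proof. by rewrite /sprod_act !act_comp. Qed.

Definition sprod : sset := Sset sprod_act_id sprod_act_comp.

Definition sprod_fst : smap sprod K :=
  @Smap sprod K (fun k x => x.1) (fun _ _ _ _ => erefl).
End Product.

Definition edge (L : sset) (x y : L 0) : Prop :=
  exists e : L 1, act L (coface ord_max) e = x /\ act L (coface ord0) e = y.

(* Equality in pi_0 L. *)
Definition same_component (L : sset) (x y : L 0) : Prop :=
  clos_refl_sym_trans _ (@edge L) x y.

Inductive join_obj (A B : sset) (k : nat) : Type :=
| JoinL of A k
| JoinR of B k
| JoinLR i j of (i + j).+1 = k & A i & B j.
Arguments JoinL {A B k}.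
Arguments JoinR {A B k}.
Arguments JoinLR {A B k i j}.

Section Join.
Variables A B : sset.

(* The value at v of a monotone map, extended monotonically to nat. *)
Definition mono_nat l k (f : mono l k) (v : nat) : nat := f (inord (minn v l)).

Lemma mono_nat_mono l k (f : mono l k) u v :
  u <= v -> mono_nat f u <= mono_nat f v.
Proof. by move=> uv; apply: monoP; rewrite !inordK; lia. Qed.

Lemma mono_natE l k (f : mono l k) (v : 'I_l.+1) : mono_nat f v = f v.
Proof.
rewrite /mono_nat; congr (nat_of_ord (f _)); apply: val_inj.
by rewrite /= inordK; have := ltn_ord v; lia.
Qed.

Lemma join_left_proof l k (f : mono l k) m n (u v : 'I_m.+1) : u <= v ->
  (inord (minn (mono_nat f u) n) : 'I_n.+1) <=
  (inord (minn (mono_nat f v) n) : 'I_n.+1).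
Proof. by move=> /(mono_nat_mono f); rewrite !inordK; lia. Qed.

Lemma join_right_proof l k (f : mono l k) i p m n (u v : 'I_m.+1) : u <= v ->
  (inord (minn (mono_nat f (p + u) - i.+1) n) : 'I_n.+1) <=
  (inord (minn (mono_nat f (p + v) - i.+1) n) : 'I_n.+1).
Proof.
move=> uv; have : mono_nat f (p + u) <= mono_nat f (p + v).
  by apply: mono_nat_mono; lia.
by rewrite !inordK; lia.
Qed.

(* In [join_act], f : [l] -> [(i + j).+1] sends its first p vertices into the
   factor [i] and the others into [j]; [join_left] and [join_right] are the two
   monotone maps that it induces (the truncations by minn are then void). *)
Definition join_left l k (f : mono l k) m n : mono m n :=
  mk_mono (@join_left_proof l k f m n).
Definition join_right l k (f : mono l k) i p m n : mono m n :=
  mk_mono (@join_right_proof l k f i p m n).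

Lemma join_split l p : p < l -> (p + (l - p.+1)).+1 = l.
Proof. lia. Qed.

Definition join_act l k (f : mono l k) (x : join_obj A B k) : join_obj A B l :=
  match x with
  | JoinL a => JoinL (act A f a)
  | JoinR b => JoinR (act B f b)
  | JoinLR i j _ a b =>
      match #|[pred v : 'I_l.+1 | f v <= i]| with
      | 0 => JoinR (act B (join_right f i 0 l j) b)
      | p.+1 =>
          match @idP (p < l) with
          | ReflectT lt_pl =>
              JoinLR (join_split lt_pl) (act A (join_left f p i) a)
                (act B (join_right f i p.+1 (l - p.+1) j) b)
          | ReflectF _ => JoinL (act A (join_left f l i) a)
          end
      end
  end.

Lemma card_initial n (P : pred 'I_n) :
  (forall u v : 'I_n, u <= v -> P v -> P u) ->
  forall v : 'I_n, P v = (v < #|P|).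
Proof.
move=> dP v; have vn := ltn_ord v.
have cardlt m : m <= n -> #|[pred u : 'I_n | u < m]| = m.
  by move=> mn; rewrite -sum1_card -(big_ord_widen n (fun=> 1) mn) sum1_card card_ord.
apply/idP/idP => [Pv | ].
  rewrite -[X in X <= _](cardlt v.+1) //; apply/subset_leq_card/subsetP => u.
  by rewrite !inE ltnS => uv; apply: dP uv Pv.
apply: contraLR => nPv; rewrite -leqNgt -[X in _ <= X](cardlt v); last lia.
apply/subset_leq_card/subsetP => u Pu; rewrite inE ltnNge.
by apply: contra nPv => vu; apply: dP vu Pu.
Qed.

Lemma join_act_right l i j k (e : (i + j).+1 = k) (f : mono l k) a b
    (g : mono l j) :
  (forall v : 'I_l.+1, i.+1 + g v = f v) ->
  join_act f (JoinLR e a b) = JoinR (act B g b).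
Proof.
move=> fg /=.
have -> : #|[pred v : 'I_l.+1 | f v <= i]| = 0.
  by apply: eq_card0 => v; rewrite !inE -fg; apply/negbTE; lia.
congr (JoinR (act B _ b)); apply: mono_eq => v.
rewrite mk_monoE add0n mono_natE -fg inordK; have := ltn_ord (g v); lia.
Qed.

Lemma join_act_left l i j k (e : (i + j).+1 = k) (f : mono l k) a b
    (g : mono l i) :
  (forall v : 'I_l.+1, g v = f v :> nat) ->
  join_act f (JoinLR e a b) = JoinL (act A g a).
Proof.
move=> fg /=.
have -> : #|[pred v : 'I_l.+1 | f v <= i]| = l.+1.
  rewrite -[RHS](card_ord l.+1); apply: eq_card => v.
  by rewrite !inE -fg; have := ltn_ord (g v); lia.
case: {-}_ / idP => [h|_]; first by exfalso; lia.
congr (JoinL (act A _ a)); apply: mono_eq => v.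
by rewrite mk_monoE mono_natE -fg inordK; have := ltn_ord (g v); lia.
Qed.

Lemma join_act_both l i j k i' j' (e : (i + j).+1 = k) (e' : (i' + j').+1 = l)
    (f : mono l k) a b (g : mono i' i) (h : mono j' j) :
  (forall (v : 'I_l.+1) (u : 'I_i'.+1), v = u :> nat -> f v = g u :> nat) ->
  (forall (v : 'I_l.+1) (u : 'I_j'.+1), v = i'.+1 + u :> nat ->
    f v = i.+1 + h u :> nat) ->
  join_act f (JoinLR e a b) = JoinLR e' (act A g a) (act B h b).
Proof.
move=> fg fh /=.
have E : #|[pred v : 'I_l.+1 | f v <= i]| = i'.+1.
  have i'l : i'.+1 <= l by lia.
  have -> : i'.+1 = #|[pred v : 'I_l.+1 | v < i'.+1]|.
    by rewrite -sum1_card -(big_ord_widen l.+1 (fun=> 1)) ?sum1_card ?card_ord //; lia.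
  apply: eq_card => v; rewrite !inE; case: (ltnP v i'.+1) => vi.
    by rewrite (fg v (Ordinal vi)) //; have := ltn_ord (g (Ordinal vi)); lia.
  have vj : v - i'.+1 < j'.+1 by have := ltn_ord v; lia.
  by rewrite (fh v (Ordinal vj)) /=; lia.
rewrite E; case: {-}_ / idP => [lt|]; last by lia.
have jj : j' = l - i'.+1 by lia.
subst j'.
congr JoinLR; first exact: Prop_irrelevance.
  congr (act A _ a); apply: mono_eq => v; rewrite mk_monoE.
  have vl : v < l.+1 by have := ltn_ord v; lia.
  by rewrite (mono_natE f (Ordinal vl)) (fg _ v) // inordK; have := ltn_ord (g v); lia.
congr (act B _ b); apply: mono_eq => v; rewrite mk_monoE.
have vl : i'.+1 + v < l.+1 by have := ltn_ord v; lia.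
by rewrite (mono_natE f (Ordinal vl)) (fh _ v) // inordK; have := ltn_ord (h v); lia.
Qed.

Variant join_act_spec l i j k (f : mono l k) : Prop :=
| JoinActRight (g : mono l j) of forall v : 'I_l.+1, i.+1 + g v = f v
| JoinActLeft (g : mono l i) of forall v : 'I_l.+1, g v = f v :> nat
| JoinActBoth i' j' (e' : (i' + j').+1 = l) (g : mono i' i) (h : mono j' j) of
    (forall (v : 'I_l.+1) (u : 'I_i'.+1), v = u :> nat -> f v = g u :> nat) &
    (forall (v : 'I_l.+1) (u : 'I_j'.+1), v = i'.+1 + u :> nat ->
      f v = i.+1 + h u :> nat).

Lemma join_actP l i j k (e : (i + j).+1 = k) (f : mono l k) :
  join_act_spec i j f.
Proof.
have := @card_initial l.+1 [pred v : 'I_l.+1 | f v <= i].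
have dP (u v : 'I_l.+1) : u <= v -> f v <= i -> f u <= i.
  by move=> /(monoP f); apply: leq_trans.
move=> /(_ dP) /=; set c := #|_| => cP.
have cl : c <= l.+1 by rewrite -[X in _ <= X](card_ord l.+1) max_card.
case: (posnP c) => [c0|c_gt0].
  apply: (@JoinActRight _ _ _ _ _ (join_right f i 0 l j)) => v.
  have := cP v; rewrite c0 ltn0 mk_monoE add0n mono_natE.
  by have := ltn_ord (f v) => fv; rewrite inordK; lia.
case: (ltnP c l.+1) => [c_lt|c_ge].
  have e' : (c.-1 + (l - c)).+1 = l by lia.
  apply: (@JoinActBoth _ _ _ _ _ _ _ e' (join_left f c.-1 i)
      (join_right f i c (l - c) j)) => v u vu.
    have := cP v; rewrite mk_monoE -vu mono_natE.
    by have := ltn_ord u => uc; rewrite inordK; lia.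
  have := cP v; have fv := ltn_ord (f v).
  have -> : join_right f i c (l - c) j u = inord (minn (mono_nat f v - i.+1) j).
    by rewrite mk_monoE vu; congr (inord (minn (mono_nat f _ - _) _)); lia.
  by rewrite mono_natE inordK; lia.
apply: (@JoinActLeft _ _ _ _ _ (join_left f l i)) => v.
have := cP v; rewrite mk_monoE mono_natE.
by have := ltn_ord v => vl; rewrite inordK; lia.
Qed.

Lemma join_act_id k (x : join_obj A B k) : join_act (mono_id k) x = x.
Proof.
case: x => [a|b|i j e a b]; [by rewrite /= act_id | by rewrite /= act_id |].
rewrite (@join_act_both _ _ _ _ _ _ _ e _ _ _ (mono_id i) (mono_id j)) ?act_id //.
  by move=> v u; rewrite !mono_idE.
by move=> v u; rewrite !mono_idE.
Qed.

Lemma join_act_comp k l m (f : mono l k) (g : mono m l) (x : join_obj A B k) :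
  join_act (mono_comp f g) x = join_act g (join_act f x).
Proof.
case: x => [a|b|i j e a b]; [by rewrite /= act_comp | by rewrite /= act_comp |].
case: (join_actP e f) => [h fh|h fh|i' j' e' h h' fh fh'].
- rewrite (join_act_right e _ _ fh) [RHS]/= -act_comp; apply: join_act_right => v.
  by rewrite !mono_compE fh.
- rewrite (join_act_left e _ _ fh) [RHS]/= -act_comp; apply: join_act_left => v.
  by rewrite !mono_compE fh.
rewrite (join_act_both e e' _ _ fh fh').
case: (join_actP e' g) => [q gq|q gq|i2 j2 e2 q q' gq gq'].
- rewrite (join_act_right e' _ _ gq) -act_comp; apply: join_act_right => v.
  by rewrite !mono_compE; apply/esym/fh'; rewrite gq.
- rewrite (join_act_left e' _ _ gq) -act_comp; apply: join_act_left => v.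
  by rewrite !mono_compE; apply/esym/fh; rewrite gq.
rewrite (join_act_both e' e2 _ _ gq gq') -!act_comp; apply: join_act_both.
  by move=> v u vu; rewrite !mono_compE; apply: fh; apply: gq.
by move=> v u vu; rewrite !mono_compE; apply: fh'; apply: gq'.
Qed.

Definition join : sset := Sset join_act_id join_act_comp.

End Join.

Section JoinMap.
Variables (A B A' B' : sset) (f : smap A A') (g : smap B B').

Definition join_app k (x : join A B k) : join A' B' k :=
  match x with
  | JoinL a => JoinL (f k a)
  | JoinR b => JoinR (g k b)
  | JoinLR i j e a b => JoinLR e (f i a) (g j b)
  end.

Lemma join_app_act l k (h : mono l k) (x : join A B k) :
  join_app (act (join A B) h x) = act (join A' B') h (join_app x).
Proof.
case: x => [a|b|i j e a b] /=; rewrite ?app_act //.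
case: #|_| => [|p] /=; rewrite ?app_act //.
by case: {-}_ / idP => [lt|_] /=; rewrite !app_act.
Qed.

Definition join_map : smap (join A B) (join A' B') := Smap join_app_act.
End JoinMap.

(* The cone on L, with apex as last vertex. *)
Definition cone (L : sset) : sset := join L (simplex 0).
Definition cone_map K L (f : smap K L) : smap (cone K) (cone L) :=
  join_map f (smap_id (simplex 0)).

Section Cochains.
Local Open Scope ring_scope.
Variable R : comNzRingType.

Definition degenerate (L : sset) k : L k -> Prop :=
  match k return L k -> Prop with
  | 0 => fun=> False
  | m.+1 => fun x => exists (j : 'I_m.+1) (y : L m), x = act L (codegen j) y
  end.

Definition normalized (L : sset) k : {pred (L k -> R^o)} :=
  fun f => `[< forall x, degenerate x -> f x = 0 >].
Arguments normalized : clear implicits.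

Lemma normalized_submod L k : submod_closed (normalized L k).
Proof.
split=> [|a f g /asboolP hf /asboolP hg]; apply/asboolP => x dx //.
by rewrite -[LHS]/(a * f x + g x) hf // hg // mulr0 addr0.
Qed.

HB.instance Definition _ (L : sset) k :=
  GRing.isSubmodClosed.Build R (L k -> R^o) (normalized L k)
    (normalized_submod L k).

Record ncochain (L : sset) (k : nat) := NCochain {
  ncochain_fun :> L k -> R^o;
  ncochainP : ncochain_fun \in normalized L k
}.

HB.instance Definition _ (L : sset) k := [isSub for @ncochain_fun L k].
HB.instance Definition _ (L : sset) k := [Choice of ncochain L k by <:].
HB.instance Definition _ (L : sset) k := [SubChoice_isSubLmodule of ncochain L k by <:].

Lemma ncochain_eq L k (f g : ncochain L k) : (forall x, f x = g x) -> f = g.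
Proof. by move=> fg; apply/val_inj/funext. Qed.

Lemma ncochain_degenerate L k (f : ncochain L k) x : degenerate x -> f x = 0.
Proof. by move/asboolP: (ncochainP f); apply. Qed.

Definition cob_fun (L : sset) k (f : L k -> R^o) (x : L k.+1) : R^o :=
  \sum_(i < k.+2) (-1) ^+ i * f (act L (coface i) x).

Lemma mono_factor m n (g : mono m.+1 n) (u : 'I_m.+1) :
  g (widen_ord (leqnSn _) u) = g (lift ord0 u) ->
  g = mono_comp (mono_comp g (coface (lift ord0 u))) (codegen u).
Proof.
move=> gu; apply: mono_eq => v; rewrite !mono_compE.
have [vu|vu] := eqVneq v (lift ord0 u).
  rewrite vu -gu; congr (nat_of_ord (g _)); apply: ord_inj.
  by rewrite cofaceE codegenE /= /bump /unbump; lia.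
congr (nat_of_ord (g _)); apply: ord_inj; move: vu.
by rewrite -val_eqE cofaceE codegenE /= /bump /unbump; lia.
Qed.

Lemma cob_normalized L k (f : ncochain L k) :
  cob_fun f \in normalized L k.+1.
Proof.
apply/asboolP => _ [j [y ->]].
have deg (i : 'I_k.+2) : i != j :> nat -> i != j.+1 :> nat ->
    f (act L (coface i) (act L (codegen j) y)) = 0.
  move=> ij ij1; apply: ncochain_degenerate; rewrite -act_comp.
  have k_gt0 : (0 < k)%N by have := ltn_ord i; have := ltn_ord j; lia.
  case: k k_gt0 f j y i ij ij1 => // k _ f j y i ij ij1.
  have ub : ((if i < j then j.-1 else j) < k.+1)%N.
    by have := ltn_ord i; have := ltn_ord j; case: ifP; lia.
  exists (Ordinal ub).
  have /mono_factor e : mono_comp (codegen j) (coface i)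
        (widen_ord (leqnSn _) (Ordinal ub)) =
      mono_comp (codegen j) (coface i) (lift ord0 (Ordinal ub)).
    apply: ord_inj; rewrite !mono_compE !codegenE !cofaceE /= /bump /unbump.
    by case: ifP; lia.
  by eexists; rewrite {1}e act_comp.
have id_ (i : 'I_k.+2) : (i == j :> nat) || (i == j.+1 :> nat) ->
    act L (coface i) (act L (codegen j) y) = y.
  move=> ij; rewrite -act_comp -[RHS]act_id; congr (act L _ y).
  apply: mono_eq => v; rewrite mono_compE codegenE cofaceE mono_idE.
  by rewrite /bump /unbump; lia.
have j0 : (j < k.+2)%N by have := ltn_ord j; lia.
have j1 : (j.+1 < k.+2)%N by have := ltn_ord j; lia.
rewrite /cob_fun (bigD1 (Ordinal j0)) //= (bigD1 (Ordinal j1)) /=; last first.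
  by rewrite -val_eqE /=; lia.
rewrite big1 => [|i /andP[ij ij1]]; last first.
  by rewrite deg ?mulr0 //; move: ij ij1; rewrite -!val_eqE /=; lia.
rewrite !id_ /= ?eqxx ?orbT // addr0 exprS mulN1r mulNr subrr //.
Qed.

Definition cob L k (f : ncochain L k) : ncochain L k.+1 :=
  NCochain (cob_normalized f).

Lemma cob_linear L k : linear (@cob L k).
Proof.
move=> a f g; apply: ncochain_eq => x.
rewrite -[RHS]/(a * cob_fun f x + cob_fun g x) /= /cob_fun mulr_sumr.
rewrite -big_split /=; apply: eq_bigr => i _.
rewrite -[(a *: _ + _) _]/(a * f _ + g _).
by rewrite mulrDr mulrCA.
Qed.

HB.instance Definition _ (L : sset) k :=
  GRing.isLinear.Build R (ncochain L k) (ncochain L k.+1) _ (@cob L k)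
    (@cob_linear L k).

Section Pullback.
Variables (K L : sset) (p : smap K L).

Lemma pullback_normalized k (f : ncochain L k) :
  (fun x => f (p k x) : R^o) \in normalized K k.
Proof.
apply/asboolP => x; case: k f x => // k f x [j [y ->]].
by apply: ncochain_degenerate; exists j, (p k y); rewrite app_act.
Qed.

Definition pullback k (f : ncochain L k) : ncochain K k :=
  NCochain (pullback_normalized f).

Lemma pullback_linear k : linear (@pullback k).
Proof. by move=> a f g; apply: ncochain_eq. Qed.

HB.instance Definition _ k :=
  GRing.isLinear.Build R (ncochain L k) (ncochain K k) _ (@pullback k)
    (@pullback_linear k).

Lemma pullback_cob k (f : ncochain L k) : pullback (cob f) = cob (pullback f).
Proof.
apply: ncochain_eq => x; apply: eq_bigr => i _ /=.
by rewrite -app_act.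
Qed.
End Pullback.

Lemma pullback_id L k (f : ncochain L k) : pullback (smap_id L) f = f.
Proof. exact: ncochain_eq. Qed.

Lemma pullback_comp K L M (q : smap L M) (p : smap K L) k (f : ncochain M k) :
  pullback (smap_comp q p) f = pullback p (pullback q f).
Proof. exact: ncochain_eq. Qed.

End Cochains.

(* M (x) N as the free commutative monoid on M * N modulo bilinearity; opposites
   exist in the quotient since (- x, y) is opposite to (x, y). *)
Section Tensor.
Local Open Scope ring_scope.
Local Open Scope quotient_scope.
Variables (R : comNzRingType).

Inductive tens_rel (M N : lmodType R) : seq (M * N) -> seq (M * N) -> Prop :=
| TensRefl s : tens_rel s s
| TensSym s t : tens_rel s t -> tens_rel t s
| TensTrans s t u : tens_rel s t -> tens_rel t u -> tens_rel s u
| TensCat s s' t t' : tens_rel s s' -> tens_rel t t' ->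
    tens_rel (s ++ t) (s' ++ t')
| TensCatC s t : tens_rel (s ++ t) (t ++ s)
| TensAddL x x' y : tens_rel [:: (x + x', y)] [:: (x, y); (x', y)]
| TensAddR x y y' : tens_rel [:: (x, y + y')] [:: (x, y); (x, y')]
| TensScale a x y : tens_rel [:: (a *: x, y)] [:: (x, a *: y)]
| TensZero y : tens_rel [:: (0, y)] [::].

Section Def.
Variables M N : lmodType R.

Definition tens_relb (s t : seq (M * N)) : bool := `[< tens_rel s t >].

Lemma tens_relb_refl : reflexive tens_relb.
Proof. by move=> s; apply/asboolP/TensRefl. Qed.
Lemma tens_relb_sym : symmetric tens_relb.
Proof. by move=> s t; apply/asboolP/asboolP; apply: TensSym. Qed.
Lemma tens_relb_trans : transitive tens_relb.
Proof.
by move=> t s u /asboolP st /asboolP tu; apply/asboolP/(TensTrans st tu).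
Qed.

Canonical tens_equiv :=
  EquivRel tens_relb tens_relb_refl tens_relb_sym tens_relb_trans.

Definition tens := {eq_quot tens_equiv}.
HB.instance Definition _ := Choice.on tens.
HB.instance Definition _ := EqQuotient.on tens.

Lemma tens_eqP s t : tens_rel s t <-> \pi_tens s = \pi_tens t.
Proof.
split=> [st|/eqquotP/asboolP //].
by apply/eqquotP/asboolP.
Qed.
End Def.

Lemma map_tens_rel (M N M' N' : lmodType R) (f : {linear M -> M'})
    (g : {linear N -> N'}) s t : tens_rel s t ->
  tens_rel [seq (f z.1, g z.2) | z <- s] [seq (f z.1, g z.2) | z <- t].
Proof.
elim=> /= {s t}.
- by move=> s; apply: TensRefl.
- by move=> s t _; apply: TensSym.
- by move=> s t u _ st _; apply: TensTrans.
- by move=> s s' t t' _ ss' _ tt'; rewrite !map_cat; apply: TensCat.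
- by move=> s t; rewrite !map_cat; apply: TensCatC.
- by move=> x x' y; rewrite linearD; apply: TensAddL.
- by move=> x y y'; rewrite linearD; apply: TensAddR.
- by move=> a x y; rewrite !linearZ; apply: TensScale.
- by move=> y; rewrite linear0; apply: TensZero.
Qed.

Section Map.
Variables M N M' N' : lmodType R.

Definition tmap (f : {linear M -> M'}) (g : {linear N -> N'}) :
    tens M N -> tens M' N' :=
  locked (fun t => \pi_(tens M' N') [seq (f z.1, g z.2) | z <- repr t]).

Lemma tmap_pi f g s :
  tmap f g (\pi_(tens M N) s) =
  \pi_(tens M' N') [seq (f z.1, g z.2) | z <- s].
Proof. by rewrite /tmap -lock; apply/tens_eqP/map_tens_rel/tens_eqP; rewrite reprK. Qed.
End Map.

Section Module.
Variables M N : lmodType R.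
Implicit Types s t : seq (M * N).

Definition tadd : tens M N -> tens M N -> tens M N :=
  locked (fun x y => \pi_(tens M N) (repr x ++ repr y)).
Definition tscale (a : R) (x : tens M N) : tens M N :=
  tmap (a \*: idfun) idfun x.

Lemma tadd_pi s t : tadd (\pi_(tens M N) s) (\pi_(tens M N) t) = \pi_(tens M N) (s ++ t).
Proof. by rewrite /tadd -lock; apply/tens_eqP/TensCat; apply/tens_eqP; rewrite reprK. Qed.

Lemma tscale_pi a s : tscale a (\pi_(tens M N) s) =
  \pi_(tens M N) [seq (a *: z.1, z.2) | z <- s].
Proof. exact: tmap_pi. Qed.

Lemma taddA : associative tadd.
Proof.
move=> x y z; elim/quotW: x => s; elim/quotW: y => t; elim/quotW: z => u.
by rewrite !tadd_pi catA.
Qed.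

Lemma taddC : commutative tadd.
Proof.
move=> x y; elim/quotW: x => s; elim/quotW: y => t; rewrite !tadd_pi.
by apply/tens_eqP; apply: TensCatC.
Qed.

Lemma tadd0 : left_id (\pi_(tens M N) [::]) tadd.
Proof. by move=> x; elim/quotW: x => s; rewrite tadd_pi. Qed.

Lemma tscaleA a b x : tscale a (tscale b x) = tscale (a * b) x.
Proof.
elim/quotW: x => s; rewrite !tscale_pi -map_comp; congr \pi.
by apply: eq_map => z /=; rewrite scalerA.
Qed.

Lemma tscale1 : left_id 1 tscale.
Proof.
move=> x; elim/quotW: x => s; rewrite tscale_pi; congr \pi.
by rewrite -[RHS]map_id; apply: eq_map => -[x y]; rewrite scale1r.
Qed.

Lemma tscaleDr : right_distributive tscale tadd.
Proof.
move=> a x y; elim/quotW: x => s; elim/quotW: y => t.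
by rewrite tadd_pi !tscale_pi tadd_pi map_cat.
Qed.

Lemma tscaleDl x : {morph tscale^~ x : a b / a + b >-> tadd a b}.
Proof.
move=> a b; elim/quotW: x => s; rewrite !tscale_pi tadd_pi; apply/tens_eqP.
elim: s => [|[x y] s IH] /=; first exact: TensRefl.
rewrite scalerDl -cat1s.
apply: TensTrans (TensCat (TensAddL _ _ _) IH) _.
set A := [seq _ | z <- s]; set B := [seq _ | z <- s].
apply: (@TensCat _ _ [:: _] [:: _] ([:: _] ++ A ++ B) (A ++ [:: _] ++ B)).
  exact: TensRefl.
by rewrite !catA; apply: TensCat; [apply: TensCatC | apply: TensRefl].
Qed.

Lemma tscale0 x : tscale 0 x = \pi_(tens M N) [::].
Proof.
elim/quotW: x => s; rewrite tscale_pi; apply/tens_eqP.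
elim: s => [|[x y] s IH] /=; first exact: TensRefl.
by rewrite scale0r -cat1s -[X in tens_rel _ X]cat0s; apply: TensCat => //; apply: TensZero.
Qed.

Lemma taddN : left_inverse (\pi_(tens M N) [::]) (tscale (-1)) tadd.
Proof.
by move=> x; rewrite -[X in tadd _ X]tscale1 -tscaleDl addNr tscale0.
Qed.

HB.instance Definition _ :=
  GRing.isZmodule.Build (tens M N) taddA taddC tadd0 taddN.
HB.instance Definition _ :=
  GRing.Zmodule_isLmodule.Build R (tens M N) tscaleA tscale1 tscaleDr tscaleDl.
End Module.

Lemma tadd_piE (M N : lmodType R) (s t : seq (M * N)) :
  \pi_(tens M N) s + \pi_(tens M N) t = \pi_(tens M N) (s ++ t).
Proof. exact: tadd_pi. Qed.

Lemma tscale_piE (M N : lmodType R) a (s : seq (M * N)) :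
  a *: \pi_(tens M N) s = \pi_(tens M N) [seq (a *: z.1, z.2) | z <- s].
Proof. exact: tscale_pi. Qed.

Lemma tmap_linear (M N M' N' : lmodType R) f g : linear (@tmap M N M' N' f g).
Proof.
move=> a x y; elim/quotW: x => s; elim/quotW: y => t.
rewrite tscale_piE tadd_piE !tmap_pi tscale_piE tadd_piE map_cat -!map_comp.
by congr (\pi_(tens M' N') (_ ++ _)); apply: eq_map => z /=; rewrite linearZ.
Qed.

HB.instance Definition _ (M N M' N' : lmodType R) f g :=
  GRing.isLinear.Build R (tens M N) (tens M' N') _ (tmap f g)
    (@tmap_linear M N M' N' f g).

Lemma tmap_id (M N : lmodType R) (f : {linear M -> M}) (g : {linear N -> N}) t :
  f =1 id -> g =1 id -> tmap f g t = t.
Proof.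
move=> f1 g1; elim/quotW: t => s; rewrite tmap_pi; congr \pi.
by rewrite -[RHS]map_id; apply: eq_map => -[x y] /=; rewrite f1 g1.
Qed.

Lemma tmap_square (M N M1 N1 M2 N2 M' N' : lmodType R)
    (f1 : {linear M -> M1}) (g1 : {linear N -> N1})
    (f2 : {linear M1 -> M'}) (g2 : {linear N1 -> N'})
    (f3 : {linear M -> M2}) (g3 : {linear N -> N2})
    (f4 : {linear M2 -> M'}) (g4 : {linear N2 -> N'}) t :
  f2 \o f1 =1 f4 \o f3 -> g2 \o g1 =1 g4 \o g3 ->
  tmap f2 g2 (tmap f1 g1 t) = tmap f4 g4 (tmap f3 g3 t).
Proof.
move=> ef eg; elim/quotW: t => s; rewrite !tmap_pi -!map_comp; congr \pi.
by apply: eq_map => -[x y] /=; congr pair; [exact: ef | exact: eg].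
Qed.

Lemma tmap_comp (M N M1 N1 M' N' : lmodType R)
    (f1 : {linear M -> M1}) (g1 : {linear N -> N1})
    (f2 : {linear M1 -> M'}) (g2 : {linear N1 -> N'})
    (f : {linear M -> M'}) (g : {linear N -> N'}) t :
  f =1 f2 \o f1 -> g =1 g2 \o g1 ->
  tmap f g t = tmap f2 g2 (tmap f1 g1 t).
Proof.
move=> ef eg; elim/quotW: t => s; rewrite !tmap_pi -!map_comp; congr \pi.
by apply: eq_map => -[x y] /=; rewrite ef eg.
Qed.

Lemma tens_trivial (M N : lmodType R) (t : tens M N) :
  (forall y : N, y = 0) -> t = 0.
Proof.
move=> N0; elim/quotW: t => s; rewrite -[RHS]/(\pi_(tens M N) [::]).
apply/tens_eqP; elim: s => [|[x y] s IH]; first exact: TensRefl.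
apply: (@TensCat _ _ [:: _] [::] s [::] _ IH).
rewrite (N0 y) -(scale0r 0).
apply: TensTrans (TensSym (TensScale _ _ _)) _.
by rewrite scale0r; apply: TensZero.
Qed.

End Tensor.

Section Cocycles.
Local Open Scope ring_scope.
Variable R : comNzRingType.

Definition cocycle (L : sset) (n : nat) : Type :=
  {f : ncochain R L n | cob f == 0}.

Lemma pull_cocycle_proof K L (p : smap K L) n (f : cocycle L n) :
  cob (pullback p (val f)) == 0.
Proof. by rewrite -pullback_cob (eqP (valP f)) linear0. Qed.

Definition pull_cocycle K L (p : smap K L) n (f : cocycle L n) : cocycle K n :=
  exist _ (pullback p (val f)) (pull_cocycle_proof p f).

Definition EM_act n l k (f : mono l k) (c : cocycle (simplex k) n) :
    cocycle (simplex l) n :=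
  pull_cocycle (simplex_map f) c.

Lemma EM_act_id n k (c : cocycle (simplex k) n) : EM_act (mono_id k) c = c.
Proof.
apply: val_inj; apply: ncochain_eq => x /=.
by rewrite mono_1comp.
Qed.

Lemma EM_act_comp n k l m (f : mono l k) (g : mono m l)
    (c : cocycle (simplex k) n) :
  EM_act (mono_comp f g) c = EM_act g (EM_act f c).
Proof.
apply: val_inj; apply: ncochain_eq => x /=.
by rewrite mono_compA.
Qed.

Definition EM (n : nat) : sset := Sset (@EM_act_id n) (@EM_act_comp n).

(* An element of degree n of N^*(K) (x) N^*(L) is a family of elements
   w i j of N^i(K) (x) N^j(L) that vanish for i + j <> n; the differential is
   d (u (x) v) = du (x) v + (-1)^i u (x) dv for u of degree i. *)
Definition bidegrees (K L : sset) : Type :=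
  forall i j, tens (ncochain R K i) (ncochain R L j).

Definition tens_cob_left K L (w : bidegrees K L) : bidegrees K L :=
  fun i => match i with
  | 0 => fun j => 0
  | i'.+1 => fun j => tmap (@cob R K i') idfun (w i' j)
  end.

Definition tens_cob_right K L (w : bidegrees K L) : bidegrees K L :=
  fun i j => match j with
  | 0 => 0
  | j'.+1 => tmap idfun (@cob R L j') (w i j')
  end.

Definition tens_cob K L (w : bidegrees K L) : bidegrees K L :=
  fun i j => tens_cob_left w i j + (-1) ^+ i *: tens_cob_right w i j.

Record tens_cocycle (K L : sset) (n : nat) := TensCocycle {
  tens_cocycle_val :> forall i j, tens (ncochain R K i) (ncochain R L j);
  tens_cocycle_degree : forall i j, (i + j)%N <> n -> tens_cocycle_val i j = 0;
  tens_cocycle_closed : forall i j, tens_cob tens_cocycle_val i j = 0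
}.

Lemma tens_cocycle_eq K L n (v w : tens_cocycle K L n) :
  (forall i j, v i j = w i j) -> v = w.
Proof.
case: v w => [v v1 v2] [w w1 w2] /= vw.
have e : v = w.
  apply: functional_extensionality_dep => i.
  by apply: functional_extensionality_dep => j.
by case: _ / e in w1 w2 *; congr TensCocycle; apply: Prop_irrelevance.
Qed.

Section Pull.
Variables (K L K' L' : sset) (p : smap K K') (q : smap L L') (n : nat).

Definition pull_bidegrees (w : bidegrees K' L') : bidegrees K L :=
  fun i j => tmap (@pullback R K K' p i) (@pullback R L L' q j) (w i j).

Lemma pull_tens_cob w i j :
  tens_cob (pull_bidegrees w) i j = pull_bidegrees (tens_cob w) i j.
Proof.
rewrite /tens_cob /pull_bidegrees linearD linearZ; congr (_ + _ *: _).
  case: i => [|i] /=; first by rewrite linear0.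
  by apply: tmap_square => // f; rewrite /= pullback_cob.
case: j => [|j] /=; first by rewrite linear0.
by apply: tmap_square => // f; rewrite /= pullback_cob.
Qed.

Variable w : tens_cocycle K' L' n.

Lemma pull_tens_degree i j : (i + j)%N <> n -> pull_bidegrees w i j = 0.
Proof. by move=> ij; rewrite /pull_bidegrees tens_cocycle_degree // linear0. Qed.

Lemma pull_tens_closed i j : tens_cob (pull_bidegrees w) i j = 0.
Proof.
by rewrite pull_tens_cob /pull_bidegrees tens_cocycle_closed linear0.
Qed.

Definition pull_tens_cocycle : tens_cocycle K L n :=
  TensCocycle pull_tens_degree pull_tens_closed.
End Pull.

End Cocycles.

Record over := Over { total :> sset; proj : smap total (simplex 1) }.

Record omap (X Y : over) := Omap {
  omap_map :> smap X Y;
  omap_proj : forall k (x : X k), proj Y k (omap_map k x) = proj X k x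
}.

Lemma omap_eq X Y (f g : omap X Y) : (forall k x, f k x = g k x) -> f = g.
Proof.
case: f g => [f hf] [g hg] /= fg.
have e : f = g by apply: smap_eq.
by case: _ / e in hg *; rewrite (Prop_irrelevance hf hg).
Qed.

Definition omap_id X : omap X X := @Omap X X (smap_id X) (fun _ _ => erefl).

Lemma omap_comp_proj X Y Z (g : omap Y Z) (f : omap X Y) k (x : X k) :
  proj Z k (smap_comp g f k x) = proj X k x.
Proof. by rewrite /= !omap_proj. Qed.

Definition omap_comp X Y Z (g : omap Y Z) (f : omap X Y) : omap X Z :=
  Omap (omap_comp_proj g f).

Definition otimes (X : over) (L : sset) : over :=
  Over (smap_comp (proj X) (sprod_fst X L)).

Definition otimes_map_app X K L (p : smap K L) k (x : otimes X K k) :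
  otimes X L k := (x.1, p k x.2).

Lemma otimes_map_act X K L (p : smap K L) l k (f : mono l k)
    (x : otimes X K k) :
  otimes_map_app p (act (otimes X K) f x) =
  act (otimes X L) f (otimes_map_app p x).
Proof. by rewrite /otimes_map_app /= app_act. Qed.

Definition otimes_map X K L (p : smap K L) : omap (otimes X K) (otimes X L) :=
  @Omap (otimes X K) (otimes X L) (Smap (@otimes_map_act X K L p))
    (fun _ _ => erefl).

Definition otimes_fst X L : omap (otimes X L) X :=
  @Omap (otimes X L) X (sprod_fst X L) (fun _ _ => erefl).

Section Hom.
Variables X Y : over.

Definition hom_act l k (f : mono l k) (h : omap (otimes X (simplex k)) Y) :
    omap (otimes X (simplex l)) Y :=
  omap_comp h (otimes_map X (simplex_map f)).

Lemma hom_act_id k (h : omap (otimes X (simplex k)) Y) :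
  hom_act (mono_id k) h = h.
Proof.
by apply: omap_eq => m [x s] /=; rewrite /otimes_map_app /= mono_1comp.
Qed.

Lemma hom_act_comp k l m (f : mono l k) (g : mono m l)
    (h : omap (otimes X (simplex k)) Y) :
  hom_act (mono_comp f g) h = hom_act g (hom_act f h).
Proof.
by apply: omap_eq => p [x s] /=; rewrite /otimes_map_app /= mono_compA.
Qed.

Definition homD : sset := Sset hom_act_id hom_act_comp.

(* A morphism is a vertex of Hom^Delta, since X (x) Delta[0] = X. *)
Definition hom_vertex (f : omap X Y) : homD 0 :=
  omap_comp f (otimes_fst X (simplex 0)).

Definition homotopic (f g : omap X Y) : Prop :=
  same_component (hom_vertex f) (hom_vertex g).
End Hom.

Definition homotopy_equivalence X Y (f : omap X Y) : Prop :=
  exists g : omap Y X,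
    homotopic (omap_comp g f) (omap_id X) /\
    homotopic (omap_comp f g) (omap_id Y).

Definition homotopy_equivalent X Y : Prop :=
  exists f : omap X Y, homotopy_equivalence f.

(* Presheaves on the category of simplices of Delta[1], in which a morphism from
   tau : [l] -> [1] to sigma : [k] -> [1] is f : [l] -> [k] with
   tau = sigma o f. *)
Record presheaf := Presheaf {
  pobj :> forall k, simplex 1 k -> Type;
  pact : forall l k (f : mono l k) (sigma : simplex 1 k) (tau : simplex 1 l),
    tau = mono_comp sigma f -> pobj sigma -> pobj tau;
  pact_id : forall k (sigma : simplex 1 k)
    (e : sigma = mono_comp sigma (mono_id k)) (x : pobj sigma), pact e x = x;
  pact_comp : forall k l m (f : mono l k) (g : mono m l)
    (sigma : simplex 1 k) (tau : simplex 1 l) (rho : simplex 1 m)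
    (ef : tau = mono_comp sigma f) (eg : rho = mono_comp tau g)
    (efg : rho = mono_comp sigma (mono_comp f g)) (x : pobj sigma),
    pact efg x = pact eg (pact ef x)
}.
Arguments pact p {l k f sigma tau} e x.

(* The simplicial set over Delta[1] that corresponds to a presheaf F: its
   simplices over sigma are the elements of F sigma. *)
Section OverPresheaf.
Variable F : presheaf.

Definition tot_obj k : Type := {sigma : simplex 1 k & F k sigma}.

Definition tot_act l k (f : mono l k) (x : tot_obj k) : tot_obj l :=
  existT _ (mono_comp (projT1 x) f) (pact F erefl (projT2 x)).

Lemma tot_act_eq l k (f : mono l k) (sigma : simplex 1 k) (x : F k sigma)
    (tau : simplex 1 l) (e : tau = mono_comp sigma f) :
  tot_act f (existT _ sigma x) = existT _ tau (pact F e x).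
Proof. by subst tau. Qed.

Lemma tot_act_id k (x : tot_obj k) : tot_act (mono_id k) x = x.
Proof.
case: x => sigma x; rewrite (tot_act_eq x (esym (mono_comp1 sigma))).
by rewrite pact_id.
Qed.

Lemma tot_act_comp k l m (f : mono l k) (g : mono m l) (x : tot_obj k) :
  tot_act (mono_comp f g) x = tot_act g (tot_act f x).
Proof.
case: x => sigma x; rewrite [tot_act f _]/tot_act /=.
rewrite (tot_act_eq x (esym (mono_compA _ _ _))).
by congr existT; apply: pact_comp.
Qed.

Definition tot : sset := Sset tot_act_id tot_act_comp.

Definition over_of_presheaf : over :=
  Over (@Smap tot (simplex 1) (fun k x => projT1 x) (fun _ _ _ _ => erefl)).
End OverPresheaf.

(* The face of Delta[k] spanned by the vertices over eps: it is Delta[a] for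
   eps = 0 and Delta[b] for eps = 1 when sigma is Delta[a] * Delta[b]. *)
Section Fibre.
Variables (k : nat) (sigma : simplex 1 k) (eps : 'I_2).

Definition fibre_obj m : Type :=
  {x : mono m k | [forall v, sigma (x v) == eps]}.

Lemma fibre_act_proof l m (f : mono l m) (x : fibre_obj m) :
  [forall v, sigma (mono_comp (val x) f v) == eps].
Proof.
by apply/forallP => v; rewrite mono_compE; move/forallP: (valP x); apply.
Qed.

Definition fibre_act l m (f : mono l m) (x : fibre_obj m) : fibre_obj l :=
  exist _ (mono_comp (val x) f) (fibre_act_proof f x).

Lemma fibre_act_id m (x : fibre_obj m) : fibre_act (mono_id m) x = x.
Proof. by apply: val_inj; apply: mono_comp1. Qed.

Lemma fibre_act_comp m l p (f : mono l m) (g : mono p l) (x : fibre_obj m) :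
  fibre_act (mono_comp f g) x = fibre_act g (fibre_act f x).
Proof. by apply: val_inj; apply: mono_compA. Qed.

Definition fibre : sset := Sset fibre_act_id fibre_act_comp.
End Fibre.

Section FibreMap.
Variables (l k : nat) (f : mono l k) (sigma : simplex 1 k) (tau : simplex 1 l).
Hypothesis e : tau = mono_comp sigma f.
Variable eps : 'I_2.

Lemma fibre_map_proof m (x : fibre tau eps m) :
  [forall v, sigma (mono_comp f (val x) v) == eps].
Proof.
apply/forallP => v; rewrite mono_compE.
by move/forallP/(_ v): (valP x); rewrite {1}e mono_compE.
Qed.

Definition fibre_map_app m (x : fibre tau eps m) : fibre sigma eps m :=
  exist _ (mono_comp f (val x)) (fibre_map_proof x).

Lemma fibre_map_act m p (g : mono m p) (x : fibre tau eps p) :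
  fibre_map_app (act (fibre tau eps) g x) =
  act (fibre sigma eps) g (fibre_map_app x).
Proof. by apply: val_inj; apply: mono_compA. Qed.

Definition fibre_map : smap (fibre tau eps) (fibre sigma eps) :=
  Smap fibre_map_act.
End FibreMap.

Lemma fibre_map_id k (sigma : simplex 1 k)
    (e : sigma = mono_comp sigma (mono_id k)) eps :
  fibre_map e eps = smap_id (fibre sigma eps).
Proof.
by apply: smap_eq => m x; apply: val_inj; apply: mono_1comp.
Qed.

Lemma fibre_map_comp k l m (f : mono l k) (g : mono m l)
    (sigma : simplex 1 k) (tau : simplex 1 l) (rho : simplex 1 m)
    (ef : tau = mono_comp sigma f) (eg : rho = mono_comp tau g)
    (efg : rho = mono_comp sigma (mono_comp f g)) eps :
  fibre_map efg eps = smap_comp (fibre_map ef eps) (fibre_map eg eps).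
Proof.
by apply: smap_eq => p x; apply: val_inj; apply/esym/mono_compA.
Qed.

Lemma cone_map_id K : cone_map (smap_id K) = smap_id (cone K).
Proof. by apply: smap_eq => k []. Qed.

Lemma cone_map_comp K L M (q : smap L M) (p : smap K L) :
  cone_map (smap_comp q p) = smap_comp (cone_map q) (cone_map p).
Proof. by apply: smap_eq => k []. Qed.

Section StratifiedEM.
Local Open Scope ring_scope.
Variables (R : comNzRingType) (n : nat).

Definition over0 : 'I_2 := ord0.
Definition over1 : 'I_2 := ord_max.

(* Z^n of N^*(c Delta[a]) (x) N^*(Delta[b]): the perversity oo imposes no
   condition on the cochains. Non-regular simplices need no
   separate clause: then b = -1 and N^*(Delta[b]) = 0, see
   [blowup_cocycle_nonregular]. If a = -1, then c Delta[a] is the apex and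
   N^*(c Delta[a]) is R. *)
Definition blowup_cocycle k (sigma : simplex 1 k) : Type :=
  tens_cocycle R (cone (fibre sigma over0)) (fibre sigma over1) n.

Definition blowup_act l k (f : mono l k) (sigma : simplex 1 k)
    (tau : simplex 1 l) (e : tau = mono_comp sigma f)
    (w : blowup_cocycle sigma) : blowup_cocycle tau :=
  pull_tens_cocycle (cone_map (fibre_map e over0)) (fibre_map e over1) w.

Lemma blowup_act_id k (sigma : simplex 1 k)
    (e : sigma = mono_comp sigma (mono_id k)) (w : blowup_cocycle sigma) :
  blowup_act e w = w.
Proof.
apply: tens_cocycle_eq => i j; rewrite /= /pull_bidegrees !fibre_map_id.
by rewrite cone_map_id; apply: tmap_id => c; apply: pullback_id.
Qed.

Lemma blowup_act_comp k l m (f : mono l k) (g : mono m l)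
    (sigma : simplex 1 k) (tau : simplex 1 l) (rho : simplex 1 m)
    (ef : tau = mono_comp sigma f) (eg : rho = mono_comp tau g)
    (efg : rho = mono_comp sigma (mono_comp f g)) (w : blowup_cocycle sigma) :
  blowup_act efg w = blowup_act eg (blowup_act ef w).
Proof.
apply: tens_cocycle_eq => i j; rewrite /= /pull_bidegrees.
rewrite !(fibre_map_comp ef eg efg) cone_map_comp.
by apply: tmap_comp => c; apply: pullback_comp.
Qed.

Definition blowup_presheaf : presheaf :=
  Presheaf blowup_act_id blowup_act_comp.

Definition EM_infty : over := over_of_presheaf blowup_presheaf.

Lemma blowup_cocycle_nonregular k (sigma : simplex 1 k)
    (w : blowup_cocycle sigma) :
  (forall v, sigma v = over0) -> forall i j, w i j = 0.
Proof.
move=> sigma0 i j; apply: tens_trivial => c; apply: ncochain_eq => x.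
by exfalso; move/forallP/(_ ord0): (valP x); rewrite sigma0.
Qed.

End StratifiedEM.

Definition to_point_app (K : sset) k (x : K k) : simplex 0 k :=
  @mk_mono k 0 (fun=> ord0) (fun _ _ _ => leqnn _).

Lemma to_point_act (K : sset) l k (f : mono l k) (x : K k) :
  to_point_app (act K f x) = act (simplex 0) f (to_point_app x).
Proof. by apply: mono_eq => v; rewrite mono_compE !mk_monoE. Qed.

Definition to_point (K : sset) : smap K (simplex 0) := Smap (@to_point_act K).

Lemma join_points_proof k i (u v : 'I_k.+1) : u <= v ->
  (if u <= i then over0 else over1) <= (if v <= i then over0 else over1).
Proof. by move=> uv; case: (leqP v i) => vi; [rewrite (leq_trans uv vi) | case: ifP]. Qed.

Definition join_points_app k (x : join (simplex 0) (simplex 0) k) :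
    simplex 1 k :=
  match x with
  | JoinL _ => @mk_mono k 1 (fun=> over0) (fun _ _ _ => leqnn _)
  | JoinR _ => @mk_mono k 1 (fun=> over1) (fun _ _ _ => leqnn _)
  | JoinLR i j _ _ _ => mk_mono (@join_points_proof k i)
  end.

Lemma join_points_act l k (f : mono l k) (x : join (simplex 0) (simplex 0) k) :
  join_points_app (act (join (simplex 0) (simplex 0)) f x) =
  act (simplex 1) f (join_points_app x).
Proof.
case: x => [a|b|i j e a b].
- by apply: mono_eq => v; rewrite mono_compE !mk_monoE.
- by apply: mono_eq => v; rewrite mono_compE !mk_monoE.
rewrite -[act (join _ _) f _]/(join_act f (JoinLR e a b)).
case: (join_actP e f) => [g fg|g fg|i' j' e' g h fg fh].
- rewrite (join_act_right e _ _ fg); apply: mono_eq => v.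
  have fi : (f v <= i) = false by rewrite -fg; lia.
  by rewrite mono_compE !mk_monoE fi.
- rewrite (join_act_left e _ _ fg); apply: mono_eq => v.
  by rewrite mono_compE !mk_monoE -fg leq_ord.
rewrite (join_act_both e e' _ _ fg fh); apply: mono_eq => v.
rewrite mono_compE !mk_monoE; have vl := ltn_ord v.
case: (leqP v i') => vi.
  by rewrite (fg v (Ordinal (vi : v < i'.+1))) // leq_ord.
have vj : v - i'.+1 < j'.+1 by lia.
have fi : (f v <= i) = false by rewrite (fh v (Ordinal vj)) /=; lia.
by rewrite fi.
Qed.

(* The identification of Delta[0] * Delta[0] with Delta[1]. *)
Definition join_points : smap (join (simplex 0) (simplex 0)) (simplex 1) :=
  Smap join_points_act.

Definition join_over (A B : sset) : over :=
  @Over (join A B) (smap_comp join_points (join_map (to_point A) (to_point B))).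

(* Main.v *)
(** Over a simplex sigma = Delta[a] * Delta[b], the simplices of
    Delta[0] * K(R, n) are the n-cocycles c of Delta[b], and those of
    K(R, n, [1], oo) are the n-cocycles of N^*(c Delta[a]) (x) N^*(Delta[b]).
    Restriction to the apex v of the cone is left inverse to c |-> 1 (x) c.
    The other composite is homotopic to the identity because c Delta[a]
    contracts to v: a simplex s of Delta[1] induces the simplicial map phi_s of
    c Delta[a] that sends the vertices with s = 1 to v and fixes the others, it
    is natural in (sigma, s), and (phi_s^* (x) 1) w is the required homotopy.
    It is w for s = 0; for s = 1 it is 1 (x) w|_v, as normalized cochains of
    positive degree vanish on v. *)

From HB Require Import structures.
From Stdlib Require Import Relations.Relation_Operators.
From mathcomp Require Import all_boot all_algebra.
From mathcomp Require Import zify.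
From mathcomp Require Import boolp.
Require Import Defs.

Set Implicit Arguments.
Unset Strict Implicit.
Unset Printing Implicit Defensive.

Import GRing.Theory.

Lemma simplex0_unique k (x y : simplex 0 k) : x = y.
Proof. by apply: mono_eq => v; rewrite !ord1. Qed.

(** The inverse is chosen in each dimension; injectivity of [f] then makes it commute with the
    action. *)
Lemma omap_inverse (X Y : over) (f : omap X Y) :
  (forall k, injective (f k)) -> (forall k y, exists x, f k x = y) ->
  exists2 g : omap Y X, omap_comp f g = omap_id Y & omap_comp g f = omap_id X.
Proof.
move=> finj fsurj; pose g k y := sval (cid (fsurj k y)).
have gK k y : f k (g k y) = y by rewrite /g; case: cid.
have g_act l k (a : mono l k) y : g l (act Y a y) = act X a (g k y).
  by apply: finj; rewrite app_act !gK.
have g_proj k y : proj X k (Smap g_act k y) = proj Y k y.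
  by rewrite -(omap_proj f) /= gK.
exists (Omap g_proj); apply: omap_eq => k x /=; first exact: gK.
by apply: finj; rewrite gK.
Qed.

(** * Cones and their contraction onto the apex *)

Definition vertex0 k : simplex 0 k := @mk_mono k 0 (fun=> ord0) (fun _ _ _ => leqnn _).

Definition apex (K : sset) k : cone K k := JoinR (vertex0 k).

Lemma act_apex (K : sset) l k (f : mono l k) : act (cone K) f (apex K k) = apex K l.
Proof. by congr JoinR; apply: simplex0_unique. Qed.

Lemma degenerate_apex (K : sset) k : degenerate (apex K k.+1).
Proof. by exists ord0, (apex K k); rewrite act_apex. Qed.

(** The join of [x] with the apex: collapsing a simplex with left part [x] yields a restriction of
    this one. *)
Definition cone_simplex (K : sset) k (x : K k) : cone K k.+1 :=
  JoinLR (congr1 succn (addn0 k)) x (vertex0 0).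

Lemma mono_lift_proof l k (f : mono l k) (u v : 'I_l.+2) : u <= v ->
  (if u <= l then widen_ord (leqnSn _) (f (inord u)) else ord_max) <=
  (if v <= l then widen_ord (leqnSn _) (f (inord v)) else ord_max).
Proof.
move=> uv; case: (leqP v l) => vl; last first.
  by case: ifP => //= _; have := ltn_ord (f (inord u)); lia.
by rewrite (leq_trans uv vl) /=; apply: monoP; rewrite !inordK; lia.
Qed.

(** This is the join of [f] with the identity of the apex $[0]$. *)
Definition mono_lift l k (f : mono l k) : mono l.+1 k.+1 :=
  mk_mono (@mono_lift_proof l k f).

Lemma cone_simplex_act (K : sset) l k (f : mono l k) (x : K k) :
  cone_simplex (act K f x) = act (cone K) (mono_lift f) (cone_simplex x).
Proof.
rewrite [RHS](join_act_both _ (congr1 succn (addn0 l)) _ _ (g := f) (h := mono_id 0)).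
- by rewrite act_id.
- move=> v u vu; rewrite mk_monoE vu leq_ord /=.
  by congr (nat_of_ord (f _)); apply: val_inj; rewrite /= inordK.
- by move=> v u vu; rewrite mk_monoE mono_idE vu ltn_geF ?(ord1 u) /= ?addn0 // ltnS.
Qed.

Section CollapseMono.
Variables (k i : nat) (t : simplex 1 i).

Lemma collapse_mono_proof (u v : 'I_k.+1) : u <= v ->
  ((if (u <= i) && (mono_nat t u == 0) then inord u else ord_max) : 'I_i.+2) <=
  ((if (v <= i) && (mono_nat t v == 0) then inord v else ord_max) : 'I_i.+2).
Proof.
move=> uv; have := mono_nat_mono t uv.
case: (leqP v i) => vi /= tuv; last first.
  by case: ifP => //= /andP[ui _]; rewrite inordK; lia.
have ui : u <= i by lia.
rewrite ui /=; case: ifP => tu; case: ifP => tv; rewrite ?inordK //=; lia.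
Qed.

(* Vertex i.+1 of [i.+1] stands for the apex; k may exceed i because a simplex of
   the cone may already end with copies of the apex. *)
Definition collapse_mono : mono k i.+1 := mk_mono collapse_mono_proof.
End CollapseMono.

Lemma collapse_monoE k i (t : simplex 1 i) v :
  collapse_mono k t v =
  (if (v <= i) && (mono_nat t v == 0) then v : nat else i.+1) :> nat.
Proof.
by rewrite mk_monoE; case: ifP => //= /andP[vi _]; rewrite inordK //; lia.
Qed.

Section Collapse.
Variables (K : sset) (s : smap K (simplex 1)).

(** The map $\varphi_s$ for a general [K]. Restricting [cone_simplex x] along [collapse_mono] leaves
    it to [join_act] to decide whether the result lies in [K], at the apex, or meets both. *)
Definition collapse_app k (y : cone K k) : cone K k :=
  match y with
  | JoinL x => act (cone K) (collapse_mono k (s k x)) (cone_simplex x)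
  | JoinR _ => apex K k
  | JoinLR i _ _ x _ => act (cone K) (collapse_mono k (s i x)) (cone_simplex x)
  end.

(** Both sides restrict [cone_simplex x] along the same monotone map: a vertex goes to the apex if
    it comes after [i'] or has $s = 1$, and follows [g] otherwise. The hypotheses say that [f]
    extends [g] and sends later vertices beyond [i]; for $i' = l$ the second one is vacuous. *)
Lemma collapse_mono_square l k i' i (f : mono l k) (g : mono i' i) (x : K i) :
  (forall (v : 'I_l.+1) (u : 'I_i'.+1), v = u :> nat -> f v = g u :> nat) ->
  (forall v : 'I_l.+1, i' < v -> i < f v) ->
  act (cone K) (collapse_mono l (s i' (act K g x))) (cone_simplex (act K g x)) =
  act (cone K) f (act (cone K) (collapse_mono k (s i x)) (cone_simplex x)).
Proof.
move=> fg fi; rewrite cone_simplex_act -!act_comp; congr (act _ _ _).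
apply: mono_eq => v; rewrite !mono_compE collapse_monoE mk_monoE collapse_monoE.
case: (leqP v i') => vi /=; last by rewrite ltnn (ltn_geF (fi v vi)).
have vi' : v < i'.+1 by [].
have fv := fg v (Ordinal vi') erefl; rewrite fv leq_ord mono_natE.
rewrite -[nat_of_ord v]/(nat_of_ord (Ordinal vi')) mono_natE app_act mono_compE.
case: (s i x _ == 0 :> nat) => /=; last by rewrite ltnn.
rewrite vi /=; congr (nat_of_ord (g _)).
by apply: val_inj; rewrite /= inordK.
Qed.

Lemma collapse_act l k (f : mono l k) y :
  collapse_app (act (cone K) f y) = act (cone K) f (collapse_app y).
Proof.
case: y => [x|x|i j e x z].
- apply: collapse_mono_square => [v u vu|v]; last by have := ltn_ord v; lia.
  by congr (nat_of_ord (f _)); apply: val_inj.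
- by rewrite act_apex.
rewrite -[X in collapse_app X]/(join_act f (JoinLR e x z)).
case: (join_actP e f) => [g fg|g fg|i' j' e' g h fg fh].
(* All vertices of [f] lie beyond [i], so the collapsed simplex restricts to the apex. *)
- rewrite (join_act_right e _ _ fg); apply/esym.
  rewrite -[LHS](act_comp (cone K) (collapse_mono k (s i x)) f (cone_simplex x)).
  rewrite [LHS](join_act_right _ _ _ (g := vertex0 l)).
    by congr JoinR; apply: simplex0_unique.
  move=> v; rewrite mono_compE collapse_monoE -fg ltn_geF /=; last by lia.
  by rewrite ord1 addn0.
- rewrite (join_act_left e _ _ fg); apply: collapse_mono_square => [v u vu|v].
    by rewrite -fg; congr (nat_of_ord (g _)); apply: val_inj.
  by have := ltn_ord v; lia.
rewrite (join_act_both e e' _ _ fg fh); apply: collapse_mono_square => // v vi.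
have vj : v - i'.+1 < j'.+1 by have := ltn_ord v; lia.
by rewrite (fh v (Ordinal vj)) /=; lia.
Qed.

Definition collapse : smap (cone K) (cone K) := Smap collapse_act.

Lemma collapse_id : (forall k x v, s k x v = ord0) -> collapse = smap_id (cone K).
Proof.
move=> s0; apply: smap_eq => k [x|x|i j e x z].
- rewrite [LHS](join_act_left _ _ _ (g := mono_id k)) ?act_id // => v.
  by rewrite collapse_monoE mono_natE s0 mono_idE leq_ord.
- by congr JoinR; apply: simplex0_unique.
rewrite [LHS](join_act_both _ e _ _ (g := mono_id i)
    (h := @mk_mono j 0 (fun=> ord0) (fun _ _ _ => leqnn _))).
- by rewrite act_id; congr JoinLR; apply: simplex0_unique.
- by move=> v u vu; rewrite collapse_monoE vu mono_natE s0 mono_idE leq_ord.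
by move=> v u vu; rewrite collapse_monoE vu mk_monoE addn0 ltn_geF //; lia.
Qed.

Lemma collapse_apex k y :
  (forall k x v, s k x v = ord_max) -> collapse k y = apex K k.
Proof.
move=> s1; have cst i (x : K i) :
    act (cone K) (collapse_mono k (s i x)) (cone_simplex x) = apex K k.
  rewrite [LHS](join_act_right _ _ _ (g := vertex0 k)).
    by congr JoinR; apply: simplex0_unique.
  by move=> v; rewrite collapse_monoE /mono_nat s1 andbF ord1 addn0.
by case: y => [x|x|i j e x z]; [exact: cst | | exact: cst].
Qed.
End Collapse.

(** This makes the contractions of the individual cones assemble into one simplicial map in
    [contraction_act]. *)
Lemma collapse_natural (K L : sset) (p : smap K L) (s : smap K (simplex 1))
    (t : smap L (simplex 1)) :
  (forall k x, t k (p k x) = s k x) ->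
  smap_comp (collapse t) (cone_map p) = smap_comp (cone_map p) (collapse s).
Proof.
move=> tp; apply: smap_eq => k [x|x|i j e x z].
- by rewrite [RHS](app_act (cone_map p)) -[LHS]/(collapse_app t (JoinL (p k x))) /= tp.
- by [].
by rewrite [RHS](app_act (cone_map p)) -[LHS]/(collapse_app t (JoinLR e (p i x) z)) /= tp.
Qed.

Local Open Scope ring_scope.
Local Open Scope quotient_scope.

(** * Contraction of a tensor against a linear form, and pure tensors *)

Section Contraction.
Variables (R : comNzRingType) (M N : lmodType R) (e : {linear M -> R^o}).

(** This computes $e \otimes 1 : M \otimes N \to R \otimes N = N$ on representatives;
    [contract_seq_rel] makes it well defined. *)
Definition contract_seq (s : seq (M * N)) : N :=
  \sum_(z <- s) (e z.1 : R) *: z.2.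

Definition contract (t : tens M N) : N := contract_seq (repr t).

Lemma contract_seq_rel s t : tens_rel s t -> contract_seq s = contract_seq t.
Proof.
rewrite /contract_seq; elim=> {s t} //.
- by move=> s t u _ -> _ ->.
- by move=> s s' t t' _ ss' _ tt'; rewrite !big_cat /= ss' tt'.
- by move=> s t; rewrite !big_cat /= addrC.
- by move=> x x' y; rewrite !big_cons big_nil !addr0 linearD scalerDl.
- by move=> x y y'; rewrite !big_cons big_nil !addr0 scalerDr.
- move=> a x y; rewrite !big_cons big_nil !addr0 linearZ /= scalerA.
  by congr (_ *: _); apply: mulrC.
- by move=> y; rewrite big_cons big_nil linear0 scale0r addr0.
Qed.

Lemma contract_pi s : contract (\pi_(tens M N) s) = contract_seq s.
Proof. by apply: contract_seq_rel; apply/tens_eqP; rewrite reprK. Qed.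

Lemma contract0 : contract 0 = 0.
Proof. by rewrite -[0]/(\pi_(tens M N) [::]) contract_pi /contract_seq big_nil. Qed.

End Contraction.

Lemma contract_tmap (R : comNzRingType) (M N M' N' : lmodType R)
    (e : {linear M -> R^o}) (e' : {linear M' -> R^o}) (f : {linear M -> M'})
    (g : {linear N -> N'}) t :
  (forall x, e' (f x) = e x) ->
  contract e' (tmap f g t) = g (contract e t).
Proof.
move=> ef; elim/quotW: t => s; rewrite tmap_pi !contract_pi /contract_seq.
rewrite big_map linear_sum; apply: eq_bigr => z _ /=.
by rewrite ef linearZ.
Qed.

Section PureTensor.
Variables (R : comNzRingType) (M N : lmodType R).

Definition pure_tens (x : M) (y : N) : tens M N := \pi_(tens M N) [:: (x, y)].

Lemma pure_tens_linear x : linear (pure_tens x).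
Proof.
move=> a y z; rewrite /pure_tens tscale_piE tadd_piE; apply/tens_eqP => /=.
apply: TensTrans (TensAddR _ _ _) _.
by apply: (@TensCat _ _ _ [:: _] [:: _] [:: _] [:: _]);
  [apply/TensSym/TensScale | apply: TensRefl].
Qed.

HB.instance Definition _ x :=
  GRing.isLinear.Build R N (tens M N) _ (pure_tens x) (pure_tens_linear x).

Lemma pure_tens0l y : pure_tens 0 y = 0.
Proof. by apply/tens_eqP/TensZero. Qed.

Lemma pure_tensZ a x y : pure_tens (a *: x) y = pure_tens x (a *: y).
Proof. by apply/tens_eqP/TensScale. Qed.

Lemma contract_pure (e : {linear M -> R^o}) x y :
  contract e (pure_tens x y) = (e x : R) *: y.
Proof. by rewrite contract_pi /contract_seq big_seq1. Qed.

(** As [f] factors through [R] via [e], the map $f \otimes 1$ factors through $R \otimes N = N$ via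
    [contract e]. It is used for the pullback in degree 0 along the constant map to the apex, with
    [x] the cochain 1. *)
Lemma tmap_rank1 (e : {linear M -> R^o}) (x : M) (f : {linear M -> M})
    (g : {linear N -> N}) t :
  (forall y, f y = (e y : R) *: x) -> g =1 id ->
  tmap f g t = pure_tens x (contract e t).
Proof.
move=> fe g1; elim/quotW: t => s; rewrite tmap_pi contract_pi /contract_seq.
elim: s => [|[y z] s IH]; first by rewrite big_nil linear0.
rewrite big_cons linearD /= -IH -pure_tensZ -fe tadd_piE.
by rewrite g1.
Qed.

End PureTensor.

Lemma tmap0l (R : comNzRingType) (M N M' N' : lmodType R)
    (f : {linear M -> M'}) (g : {linear N -> N'}) t :
  (forall y, f y = 0) -> tmap f g t = 0.
Proof.
move=> f0; elim/quotW: t => s; rewrite tmap_pi.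
elim: s => [|[y z] s IH] //=.
by rewrite -cat1s -tadd_piE IH f0 addr0; apply: pure_tens0l.
Qed.

Lemma tmap_pure (R : comNzRingType) (M N M' N' : lmodType R)
    (f : {linear M -> M'}) (g : {linear N -> N'}) x y :
  tmap f g (pure_tens x y) = pure_tens (f x) (g y).
Proof. exact: tmap_pi. Qed.

(** * Cochains on a cone and their values at the apex *)

Section ConeCochains.
Variables (R : comNzRingType) (K : sset).

(** The degree 0 part of the restriction to $\{v\}$, whose positive-degree part is zero on
    normalized cochains. *)
Definition eval_apex (u : ncochain R (cone K) 0) : R^o := u (apex K 0).

Lemma eval_apex_linear : linear eval_apex.
Proof. by []. Qed.

HB.instance Definition _ :=
  GRing.isLinear.Build R (ncochain R (cone K) 0) R^o _ eval_apex eval_apex_linear.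

Lemma const1_normalized : (fun _ : K 0%N => 1 : R^o) \in @normalized R K 0.
Proof. by apply/asboolP. Qed.

Definition const1 : ncochain R K 0 := NCochain const1_normalized.

Lemma cob_const1 : cob const1 = 0.
Proof.
apply: ncochain_eq => x; rewrite -[RHS]/(0 : R) /= /cob_fun !big_ord_recl big_ord0.
by rewrite /= expr0 expr1 !mulr1 addr0 subrr.
Qed.

End ConeCochains.

Lemma pullback_const1 (R : comNzRingType) (K L : sset) (p : smap K L) :
  pullback p (const1 R L) = const1 R K.
Proof. exact: ncochain_eq. Qed.

Section Constant.
Variables (R : comNzRingType) (K : sset) (p : smap (cone K) (cone K)).
Hypothesis p_apex : forall k x, p k x = apex K k.

Lemma pullback_apex0 (u : ncochain R (cone K) 0) :
  pullback p u = (eval_apex u : R) *: const1 R (cone K).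
Proof.
apply: ncochain_eq => x; rewrite -[RHS]/(eval_apex u * 1 : R) mulr1.
by rewrite /= p_apex.
Qed.

(** In positive dimension the apex simplex is degenerate, and normalized cochains vanish on it. *)
Lemma pullback_apexS i (u : ncochain R (cone K) i.+1) : pullback p u = 0.
Proof.
apply: ncochain_eq => x; rewrite /= p_apex ncochain_degenerate //.
exact: degenerate_apex.
Qed.
End Constant.

(** * The presheaf of cocycles on the fibres over 1 *)

Section Fibrewise.
Variables (R : comNzRingType) (n : nat).

(** The intermediate presheaf $\Delta[a]*\Delta[b] \mapsto \mathcal Z^n N^*(\Delta[b])$: [EM_infty]
    deforms onto it, and it is isomorphic to the join. *)
Definition fibre_cocycle k (sigma : simplex 1 k) : Type :=
  cocycle R (fibre sigma over1) n.

Definition fibre_cocycle_act l k (f : mono l k) (sigma : simplex 1 k)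
    (tau : simplex 1 l) (e : tau = mono_comp sigma f)
    (c : fibre_cocycle sigma) : fibre_cocycle tau :=
  pull_cocycle (fibre_map e over1) c.

Lemma fibre_cocycle_act_id k (sigma : simplex 1 k)
    (e : sigma = mono_comp sigma (mono_id k)) (c : fibre_cocycle sigma) :
  fibre_cocycle_act e c = c.
Proof. by apply: val_inj => /=; rewrite fibre_map_id pullback_id. Qed.

Lemma fibre_cocycle_act_comp k l m (f : mono l k) (g : mono m l)
    (sigma : simplex 1 k) (tau : simplex 1 l) (rho : simplex 1 m)
    (ef : tau = mono_comp sigma f) (eg : rho = mono_comp tau g)
    (efg : rho = mono_comp sigma (mono_comp f g)) (c : fibre_cocycle sigma) :
  fibre_cocycle_act efg c = fibre_cocycle_act eg (fibre_cocycle_act ef c).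
Proof.
by apply: val_inj => /=; rewrite (fibre_map_comp ef eg efg) pullback_comp.
Qed.

Definition fibre_presheaf : presheaf :=
  Presheaf fibre_cocycle_act_id fibre_cocycle_act_comp.

Definition EM_fibre : over := over_of_presheaf fibre_presheaf.

(** * Restriction to the apex and extension by $1 \otimes c$ *)

Section Apex.
Variables K L : sset.

(** In bidegree $(0, n+1)$ the cocycle condition reads $(1 \otimes d) w_{0,n} = 0$, and [contract]
    turns $1 \otimes d$ into $d$. *)
Lemma restrict_apex_closed (w : tens_cocycle R (cone K) L n) :
  cob (contract (@eval_apex R K) (w 0 n)) == 0.
Proof.
rewrite -(contract_tmap (f := idfun) (e' := @eval_apex R K) (@cob R L n)) //.
have := tens_cocycle_closed w 0 n.+1.
by rewrite /tens_cob /= expr0 scale1r add0r => ->; rewrite contract0.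
Qed.

Definition restrict_apex (w : tens_cocycle R (cone K) L n) : cocycle R L n :=
  exist _ (contract (@eval_apex R K) (w 0 n)) (restrict_apex_closed w).

(** A family in all degrees is required by [bidegrees]; the cast is there because the degree indexes
    the type of cochains. *)
Definition concentrated (c : cocycle R L n) j : ncochain R L j :=
  if n =P j is ReflectT e then ecast j (ncochain R L j) e (val c) else 0.

Lemma concentrated_diag c : concentrated c n = val c.
Proof. by rewrite /concentrated; case: eqP => // e; rewrite eq_axiomK. Qed.

Lemma concentrated_off c j : n <> j -> concentrated c j = 0.
Proof. by rewrite /concentrated; case: eqP. Qed.

Lemma cob_concentrated c j : cob (concentrated c j) = 0.
Proof.
have [<-|/eqP nj] := eqVneq n j; first by rewrite concentrated_diag (eqP (valP c)).
by rewrite concentrated_off // linear0.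
Qed.

Definition tens1 (c : cocycle R L n) : bidegrees R (cone K) L :=
  fun i => if i is i'.+1 then fun=> 0
    else fun j => pure_tens (const1 R (cone K)) (concentrated c j).

Lemma tens1_degree c i j : (i + j)%N <> n -> tens1 c i j = 0.
Proof.
case: i => //= ij; rewrite concentrated_off ?linear0 //.
by move=> e; apply: ij; rewrite e.
Qed.

(** Both terms of $d(1 \otimes c) = d1 \otimes c + 1 \otimes dc$ vanish. *)
Lemma tens1_closed c i j : tens_cob (tens1 c) i j = 0.
Proof.
rewrite /tens_cob; have -> : tens_cob_right (tens1 c) i j = 0.
  case: j => [|j] //=; case: i => [|i] /=; last by rewrite linear0.
  by rewrite tmap_pure /= cob_concentrated linear0.
rewrite scaler0 addr0; case: i => [|[|i]] //=; last by rewrite linear0.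
by rewrite tmap_pure /= cob_const1 pure_tens0l.
Qed.

Definition extend_apex (c : cocycle R L n) : tens_cocycle R (cone K) L n :=
  TensCocycle (tens1_degree c) (tens1_closed c).

Lemma extend_apexK c : restrict_apex (extend_apex c) = c.
Proof.
apply: val_inj; rewrite /= contract_pure concentrated_diag.
by rewrite -[X in X *: _]/(1 : R) scale1r.
Qed.

(** Pullback along the constant map [p] has rank one in degree 0, with values in the multiples of 1,
    and is zero in positive degrees. With $p = \varphi_s$ for $s = 1$ this identifies one end of the
    homotopy. *)
Lemma restrict_apexK (p : smap (cone K) (cone K)) w :
  (forall k x, p k x = apex K k) ->
  extend_apex (restrict_apex w) = pull_tens_cocycle p (smap_id L) w.
Proof.
move=> p_apex; apply: tens_cocycle_eq => -[|i] j; rewrite /= /pull_bidegrees.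
  rewrite (tmap_rank1 (e := @eval_apex R K) (x := const1 R (cone K))).
  - have [<-|/eqP nj] := eqVneq n j; first by rewrite concentrated_diag.
    rewrite concentrated_off // tens_cocycle_degree ?contract0 //.
    by move=> e; apply: nj; rewrite -e.
  - exact: pullback_apex0.
  by move=> u; apply: pullback_id.
by rewrite tmap0l // => u; apply: pullback_apexS.
Qed.
End Apex.

(** * Naturality, and the homotopy from the identity to restriction followed by extension *)

Lemma pull_tens_cocycle_square K L K1 L1 K2 L2 K3 L3
    (p1 : smap K K1) (q1 : smap L L1) (p2 : smap K1 K3) (q2 : smap L1 L3)
    (p3 : smap K K2) (q3 : smap L L2) (p4 : smap K2 K3) (q4 : smap L2 L3)
    (w : tens_cocycle R K3 L3 n) :
  smap_comp p2 p1 = smap_comp p4 p3 -> smap_comp q2 q1 = smap_comp q4 q3 ->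
  pull_tens_cocycle p1 q1 (pull_tens_cocycle p2 q2 w) =
  pull_tens_cocycle p3 q3 (pull_tens_cocycle p4 q4 w).
Proof.
move=> ep eq; apply: tens_cocycle_eq => i j; apply: tmap_square => u /=.
  by rewrite -!pullback_comp ep.
by rewrite -!pullback_comp eq.
Qed.

Lemma restrict_apex_pull K L K' L' (p : smap K K') (q : smap L L')
    (w : tens_cocycle R (cone K') L' n) :
  restrict_apex (pull_tens_cocycle (cone_map p) q w) =
  pull_cocycle q (restrict_apex w).
Proof. by apply: val_inj; rewrite /= (contract_tmap (e := @eval_apex R K')). Qed.

Lemma concentrated_pull L L' (q : smap L L') (c : cocycle R L' n) j :
  concentrated (pull_cocycle q c) j = pullback q (concentrated c j).
Proof.
have [<-|/eqP nj] := eqVneq n j; first by rewrite !concentrated_diag.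
by rewrite !concentrated_off // linear0.
Qed.

Lemma extend_apex_pull K L K' L' (p : smap K K') (q : smap L L')
    (c : cocycle R L' n) :
  extend_apex K (pull_cocycle q c) =
  pull_tens_cocycle (cone_map p) q (extend_apex K' c).
Proof.
apply: tens_cocycle_eq => -[|i] j; rewrite /= /pull_bidegrees /= ?linear0 //.
by rewrite tmap_pure /= pullback_const1 concentrated_pull.
Qed.

Definition to_fibre_app k (x : EM_infty R n k) : EM_fibre k :=
  existT _ (projT1 x) (restrict_apex (projT2 x)).

Lemma to_fibre_act l k (f : mono l k) (x : EM_infty R n k) :
  to_fibre_app (act (EM_infty R n) f x) = act EM_fibre f (to_fibre_app x).
Proof. by congr existT; apply: restrict_apex_pull. Qed.

Definition to_fibre : omap (EM_infty R n) EM_fibre :=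
  @Omap (EM_infty R n) EM_fibre (Smap to_fibre_act) (fun _ _ => erefl).

Definition from_fibre_app k (x : EM_fibre k) : EM_infty R n k :=
  existT _ (projT1 x) (extend_apex (fibre (projT1 x) over0) (projT2 x)).

Lemma from_fibre_act l k (f : mono l k) (x : EM_fibre k) :
  from_fibre_app (act EM_fibre f x) = act (EM_infty R n) f (from_fibre_app x).
Proof. by congr existT; apply: extend_apex_pull. Qed.

Definition from_fibre : omap EM_fibre (EM_infty R n) :=
  @Omap EM_fibre (EM_infty R n) (Smap from_fibre_act) (fun _ _ => erefl).

Lemma to_from_fibre : omap_comp to_fibre from_fibre = omap_id EM_fibre.
Proof.
by apply: omap_eq => k [sigma c]; congr existT; apply: extend_apexK.
Qed.

(** Here [s] is the homotopy parameter, a second map to $[1]$ independent of [sigma]; it is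
    restricted to a face of [sigma]. *)
Definition fibre_simplex k (sigma : simplex 1 k) eps (s : simplex 1 k) :
    smap (fibre sigma eps) (simplex 1) :=
  @Smap (fibre sigma eps) (simplex 1) (fun m x => mono_comp s (val x))
    (fun _ _ f x => mono_compA s (val x) f).

Definition contraction_app k (x : otimes (EM_infty R n) (simplex 1) k) :
    EM_infty R n k :=
  existT _ (projT1 x.1)
    (pull_tens_cocycle (collapse (fibre_simplex (projT1 x.1) over0 x.2))
      (smap_id _) (projT2 x.1)).

Lemma contraction_act l k (f : mono l k)
    (x : otimes (EM_infty R n) (simplex 1) k) :
  contraction_app (act (otimes (EM_infty R n) (simplex 1)) f x) =
  act (EM_infty R n) f (contraction_app x).
Proof.
congr existT; apply: pull_tens_cocycle_square; last exact: smap_eq.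
apply/esym/collapse_natural => m y; apply: mono_eq => v.
by rewrite !mono_compE.
Qed.

Definition contraction : homD (EM_infty R n) (EM_infty R n) 1 :=
  @Omap (otimes (EM_infty R n) (simplex 1)) (EM_infty R n)
    (Smap contraction_act) (fun _ _ => erefl).

Lemma from_to_fibre :
  homotopic (omap_comp from_fibre to_fibre) (omap_id (EM_infty R n)).
Proof.
(* The edge starts at the identity, hence the symmetry: [coface ord_max] is the end $s = 0$, where
   nothing collapses, and [coface ord0] is the end $s = 1$. *)
apply/rst_sym/rst_step; exists contraction; split; apply: omap_eq => k [[sigma w] z].
  rewrite /= /contraction_app /=; congr existT.
  rewrite collapse_id.
    apply: tens_cocycle_eq => i j; rewrite /= /pull_bidegrees.
    by apply: tmap_id => u; apply: pullback_id.
  by move=> m y v; apply: val_inj; rewrite !mono_compE mk_monoE !(ord1 (z _)).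
rewrite /= /contraction_app /=; congr existT.
apply/esym/restrict_apexK => m y; apply: collapse_apex => {}m {}y v.
by apply: val_inj; rewrite !mono_compE mk_monoE !(ord1 (z _)).
Qed.

End Fibrewise.

(** * The fibre over 1 as a standard simplex *)

Section JoinFibre.
Local Open Scope nat_scope.

Lemma shift_left_proof m k (x : mono m k) p j (u v : 'I_m.+1) : u <= v ->
  (inord (minn (x u - p) j) : 'I_j.+1) <= (inord (minn (x v - p) j) : 'I_j.+1).
Proof. by move=> /(monoP x) xuv; rewrite !inordK; lia. Qed.

(* Only used where p <= x v <= p + j, so that neither truncation is effective. *)
Definition shift_left m k (x : mono m k) p j : mono m j :=
  mk_mono (@shift_left_proof m k x p j).

Lemma shift_leftE m k (x : mono m k) p j v :
  shift_left x p j v = minn (x v - p) j :> nat.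
Proof. by rewrite mk_monoE inordK //; lia. Qed.

Section FibreSimplex.
Variables (k p j : nat) (sigma : simplex 1 k).

Lemma fibre_to_simplex_act l m (f : mono l m) (x : fibre sigma over1 m) :
  shift_left (val (act (fibre sigma over1) f x)) p j =
  act (simplex j) f (shift_left (val x) p j).
Proof. by apply: mono_eq => v; rewrite mono_compE !shift_leftE mono_compE. Qed.

(** Truncation makes this total in [p], [j] and [sigma], so that [from_join_app] carries no proofs.
    It is an isomorphism when the vertices over 1 are the last [j.+1] ones, starting at [p]. *)
Definition fibre_to_simplex : smap (fibre sigma over1) (simplex j) :=
  @Smap (fibre sigma over1) (simplex j) (fun m x => shift_left (val x) p j)
    fibre_to_simplex_act.

Hypothesis pjk : p + j = k.
Hypothesis sigmaP : forall v : 'I_k.+1, (sigma v == over1) = (p <= v).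

Lemma shift_right_proof m (x : mono m j) (u v : 'I_m.+1) : u <= v ->
  (inord (p + x u) : 'I_k.+1) <= (inord (p + x v) : 'I_k.+1).
Proof.
move=> /(monoP x) xuv.
by have xu := ltn_ord (x u); have xv := ltn_ord (x v); rewrite !inordK; lia.
Qed.

Definition shift_right m (x : mono m j) : mono m k :=
  mk_mono (@shift_right_proof m x).

Lemma shift_rightE m (x : mono m j) v : shift_right x v = p + x v :> nat.
Proof. by have xv := ltn_ord (x v); rewrite mk_monoE inordK; lia. Qed.

Lemma shift_right_fibre m (x : mono m j) :
  [forall v, sigma (shift_right x v) == over1].
Proof. by apply/forallP => v; rewrite sigmaP shift_rightE leq_addr. Qed.

Definition simplex_to_fibre_app m (x : simplex j m) : fibre sigma over1 m :=
  exist _ (shift_right x) (shift_right_fibre x).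

Lemma simplex_to_fibre_act l m (f : mono l m) (x : simplex j m) :
  simplex_to_fibre_app (act (simplex j) f x) =
  act (fibre sigma over1) f (simplex_to_fibre_app x).
Proof.
apply: val_inj; apply: mono_eq => v.
by rewrite [X in _ = nat_of_ord X](mono_compE (shift_right x)) !shift_rightE mono_compE.
Qed.

Definition simplex_to_fibre : smap (simplex j) (fibre sigma over1) :=
  Smap simplex_to_fibre_act.

Lemma simplex_to_fibreK :
  smap_comp fibre_to_simplex simplex_to_fibre = smap_id (simplex j).
Proof.
apply: smap_eq => m x; apply: mono_eq => v.
rewrite shift_leftE shift_rightE -[smap_id _ m x]/x.
by have := ltn_ord (x v); lia.
Qed.

Lemma fibre_to_simplexK :
  smap_comp simplex_to_fibre fibre_to_simplex = smap_id (fibre sigma over1).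
Proof.
apply: smap_eq => m x; apply: val_inj; apply: mono_eq => v.
rewrite shift_rightE shift_leftE -[val (smap_id _ m x)]/(val x).
have := sigmaP (val x v); rewrite (forallP (valP x) v) => /esym.
by have := ltn_ord (val x v); lia.
Qed.

Variables (R : comNzRingType) (n : nat).

Lemma pull_fibre_inj : injective (@pull_cocycle R _ _ fibre_to_simplex n).
Proof.
move=> c d /(congr1 val) cd; apply: val_inj.
rewrite -[val c]pullback_id -[val d]pullback_id -simplex_to_fibreK.
by rewrite !pullback_comp; congr pullback.
Qed.

Lemma pull_fibre_surj (c : cocycle R (fibre sigma over1) n) :
  exists d, pull_cocycle fibre_to_simplex d = c.
Proof.
exists (pull_cocycle simplex_to_fibre c); apply: val_inj => /=.
by rewrite -pullback_comp fibre_to_simplexK pullback_id.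
Qed.
End FibreSimplex.

(** * The isomorphism of $\Delta[0]*K(R,n)$ with the presheaf of fibre cocycles *)

Variables (R : comNzRingType) (n : nat).

Definition constant_simplex k (eps : 'I_2) : simplex 1 k :=
  @mk_mono k 1 (fun=> eps) (fun _ _ _ => leqnn _).

Definition step_simplex k i : simplex 1 k := mk_mono (@join_points_proof k i).

(** Used over non-regular simplices, where the fibre [L] is empty and this is the only cocycle. *)
Definition zero_cocycle (L : sset) : cocycle R L n :=
  exist _ 0%R (introT eqP (raddf0 (@cob R L n))).

Lemma step_simplex_over1 k i (v : 'I_k.+1) :
  (step_simplex k i v == over1) = (i < v).
Proof. by rewrite mk_monoE; case: leqP. Qed.

(** Since $\Delta[0]$ has one simplex in each dimension, only the shape of [y] and its cocycle carry
    information. In the mixed case the first vertex over 1 is [i.+1], hence the shift. *)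
Definition from_join_app k (y : join_over (simplex 0) (EM R n) k) :
    EM_fibre R n k :=
  match y with
  | JoinL _ => existT _ (constant_simplex k over0) (zero_cocycle _)
  | JoinR c => existT _ (constant_simplex k over1)
      (pull_cocycle (fibre_to_simplex 0 k _) c)
  | JoinLR i j _ _ c => existT _ (step_simplex k i)
      (pull_cocycle (fibre_to_simplex i.+1 j _) c)
  end.

Lemma from_join_proj k (y : join_over (simplex 0) (EM R n) k) :
  projT1 (from_join_app y) = proj (join_over (simplex 0) (EM R n)) k y.
Proof. by case: y. Qed.

Lemma fibre_cocycle_empty k (sigma : simplex 1 k) (c d : fibre_cocycle R n sigma) :
  (forall v, sigma v = over0) -> c = d.
Proof.
move=> sigma0; apply: val_inj; apply: ncochain_eq => x.
by exfalso; move/forallP/(_ ord0): (valP x); rewrite sigma0.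
Qed.

Lemma from_join_act l k (f : mono l k) (y : join_over (simplex 0) (EM R n) k) :
  from_join_app (act (join_over (simplex 0) (EM R n)) f y) =
  act (EM_fibre R n) f (from_join_app y).
Proof.
(* Equality in the total space reduces to one of cocycles, given any proof [e] of equality of the
   base simplices. *)
have actE (sigma : simplex 1 k) (c : fibre_cocycle R n sigma) tau
    (d : fibre_cocycle R n tau) (e : tau = mono_comp sigma f) :
    d = fibre_cocycle_act e c ->
    existT _ tau d = act (EM_fibre R n) f (existT _ sigma c).
  move=> ->; rewrite -[RHS]/(tot_act f _).
  by rewrite (tot_act_eq (F := fibre_presheaf R n) c e).
(* Equality of the cocycles then reduces to comparing, on vertices over 1 only, [f] followed by the
   shift by [p] with the shift by [p'] followed by [g]. *)
have cocycle_eq (sigma : simplex 1 k) (tau : simplex 1 l)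
    (e : tau = mono_comp sigma f) p j p' j' (g : mono j' j)
    (c : EM R n j) :
  (forall v : 'I_l.+1, tau v = over1 ->
    minn (f v - p) j = g (inord (minn (v - p') j')) :> nat) ->
  pull_cocycle (fibre_to_simplex p' j' tau) (act (EM R n) g c) =
  fibre_cocycle_act e (pull_cocycle (fibre_to_simplex p j sigma) c).
  move=> fg; apply: val_inj; apply: ncochain_eq => x /=.
  congr (val c _); apply: mono_eq => v.
  rewrite mono_compE shift_leftE mono_compE fg; last exact/eqP/(forallP (valP x)).
  by congr (nat_of_ord (g _)); rewrite mk_monoE.
case: y => [x|c|i j e x c].
- have e0 : constant_simplex l over0 = mono_comp (constant_simplex k over0) f.
    by apply: mono_eq => v; rewrite mono_compE !mk_monoE.
  by apply: (actE _ _ _ _ e0); apply: fibre_cocycle_empty => v; rewrite mk_monoE.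
- have e1 : constant_simplex l over1 = mono_comp (constant_simplex k over1) f.
    by apply: mono_eq => v; rewrite mono_compE !mk_monoE.
  apply: (actE _ _ _ _ e1); apply: cocycle_eq => v _; rewrite !subn0.
  rewrite (minn_idPl _) ?leq_ord //; congr (nat_of_ord (f _)); apply: val_inj.
  by rewrite /= inordK (minn_idPl _) ?leq_ord.
(* The base simplices agree because the projection of the join is simplicial. This is generalized
   before the case analysis so that each case rewrites it to its own shape. *)
have eP : projT1 (from_join_app (join_act f (JoinLR e x c))) =
    mono_comp (step_simplex k i) f.
  exact: etrans (from_join_proj _)
    (app_act (proj (join_over (simplex 0) (EM R n))) f (JoinLR e x c)).
rewrite -[act (join_over _ _) f _]/(join_act f (JoinLR e x c)); move: eP.
case: (join_actP e f) => [g fg|g fg|i' j' e' g h fg fh].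
- rewrite (join_act_right e _ _ fg) => eP.
  apply: (actE _ _ _ _ eP); apply: cocycle_eq => v _.
  have gv := ltn_ord (g v); rewrite -fg subn0.
  have -> : inord (minn v l) = v :> 'I_l.+1.
    by apply: val_inj; rewrite /= inordK (minn_idPl _) ?leq_ord.
  by lia.
- rewrite (join_act_left e _ _ fg) => eP.
  by apply: (actE _ _ _ _ eP); apply: fibre_cocycle_empty => v; rewrite mk_monoE.
rewrite (join_act_both e e' _ _ fg fh) => eP.
apply: (actE _ _ _ _ eP); apply: cocycle_eq => v /eqP; rewrite step_simplex_over1 => vi.
have vl := ltn_ord v; have vj : v - i'.+1 < j'.+1 by lia.
rewrite (fh v (Ordinal vj)) /=; last by lia.
have -> : inord (minn (v - i'.+1) j') = Ordinal vj.
  by apply: val_inj; rewrite /= inordK; lia.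
by have := ltn_ord (h (Ordinal vj)); lia.
Qed.

Definition from_join : omap (join_over (simplex 0) (EM R n)) (EM_fibre R n) :=
  @Omap (join_over (simplex 0) (EM R n)) (EM_fibre R n) (Smap from_join_act)
    from_join_proj.

Lemma step_simplex_inj k i i' : i < k -> i' < k ->
  step_simplex k i = step_simplex k i' -> i = i'.
Proof.
wlog ii' : i i' / i <= i' => [hw ik i'k eqs|ik i'k eqs].
  by case/orP: (leq_total i i') => le; [apply: hw | apply/esym/hw].
(* Vertex [i'] lies over 0 in the second step simplex, hence in the first, which forces
   [i' <= i]. *)
have i'k1 : i' < k.+1 by lia.
have := congr1 (fun s : simplex 1 k => s (Ordinal i'k1) == over1) eqs.
by rewrite !mk_monoE /= leqnn; case: (leqP i' i) => //; lia.
Qed.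

(** The images in $[1]$ of the first and last vertices tell the three kinds of simplices of the join
    apart; [step_simplex_inj] then recovers the splitting and [pull_fibre_inj] the cocycle. *)
Lemma from_join_inj k : injective (from_join k).
Proof.
pose ends (s : simplex 1 k) := (s ord0 == over1, s ord_max == over1).
have endsE (y : join_over (simplex 0) (EM R n) k) :
    ends (projT1 (from_join_app y)) = match y with
      | JoinL _ => (false, false)
      | JoinR _ => (true, true)
      | JoinLR _ _ _ _ _ => (false, true)
      end.
  by case: y => [x|c|i j e x c]; rewrite /ends /= !ffunE //= leqNgt -e ltnS leq_addr.
move=> y z yz; have : ends (projT1 (from_join_app y)) = ends (projT1 (from_join_app z)).
  by rewrite -[from_join_app y]/(from_join k y) yz.
rewrite !endsE.
case: y z yz => [x|c|i j e x c] [y|d|i' j' e' y d] //= yz _.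
- by congr JoinL; apply: simplex0_unique.
- congr JoinR; apply: (pull_fibre_inj _ _ (eq_from_Tagged yz)) => // v.
  by rewrite mk_monoE.
have ii' : i = i'.
  by apply: (@step_simplex_inj k); [lia | lia | apply: (congr1 (@projT1 _ _) yz)].
have jj' : j = j' by lia.
subst i' j'; congr JoinLR; [exact: Prop_irrelevance | exact: simplex0_unique |].
by apply: (pull_fibre_inj _ _ (eq_from_Tagged yz)) => // v; apply: step_simplex_over1.
Qed.

(** A monotone map to $[1]$ is determined by the number [c] of vertices over 0. The cases are $c =
    k+1$, $c = 0$, and the rest with $i = c-1$ and $j = k-c$. *)
Lemma simplex1P k (sigma : simplex 1 k) :
  [\/ sigma = constant_simplex k over0, sigma = constant_simplex k over1 |
      exists i j, (i + j).+1 = k /\ sigma = step_simplex k i].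
Proof.
have := @card_initial k.+1 (fun v => sigma v == over0).
set c := #|_| => cP; have {}cP v : (sigma v == over0) = (v < c).
  apply: cP => u {}v /(monoP sigma); rewrite -!val_eqE /=; lia.
have ck : c <= k.+1 by rewrite -[X in _ <= X](card_ord k.+1) max_card.
have val01 v : sigma v = (if v < c then over0 else over1).
  by rewrite -cP; apply: val_inj; case: (sigma v) => -[|[|]].
have [c0|c_gt0] := posnP c.
  by apply: Or32; apply: mono_eq => v; rewrite val01 mk_monoE c0.
have [c_le|c_gt] := leqP c k; last first.
  apply: Or31; apply: mono_eq => v; rewrite val01 mk_monoE.
  by have -> : v < c by have := ltn_ord v; lia.
apply: Or33; exists c.-1, (k - c); split; first lia.
apply: mono_eq => v; rewrite val01 mk_monoE.
by have -> : (v <= c.-1) = (v < c) by lia.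
Qed.

Lemma from_join_surj k z : exists y, from_join k y = z.
Proof.
case: z => sigma c; case: (simplex1P sigma) => [s0|s1|[i [j [e si]]]]; subst sigma.
- exists (JoinL (vertex0 k)); congr existT; apply: fibre_cocycle_empty => v.
  by rewrite mk_monoE.
- have [|v|d <-] := pull_fibre_surj (p := 0) (j := k) _ _ c => //.
    by rewrite mk_monoE.
  by exists (@JoinR _ (EM R n) k d).
have [|v|d <-] := pull_fibre_surj (p := i.+1) (j := j) _ _ c => //.
  exact: step_simplex_over1.
by exists (@JoinLR _ (EM R n) k i j e (vertex0 i) d).
Qed.
End JoinFibre.

(** * Composing the deformation onto fibre cocycles with the isomorphism to the join *)

Theorem proposition6p3 (R : idomainType) (hR : dedekind_domain R) (n : nat) :
  homotopy_equivalent (EM_infty R n) (join_over (simplex 0) (EM R n)).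
Proof.
have [g fg gf] := omap_inverse (@from_join_inj R n) (@from_join_surj R n).
exists (omap_comp g (to_fibre R n)), (omap_comp (from_fibre R n) (from_join R n)).
split.
  (* The isomorphism cancels in the middle, leaving the composite that the contraction deforms to
     the identity. *)
  have -> : omap_comp (omap_comp (from_fibre R n) (from_join R n))
      (omap_comp g (to_fibre R n)) = omap_comp (from_fibre R n) (to_fibre R n).
    apply: omap_eq => k x /=; congr (from_fibre_app _).
    exact: (congr1 (fun h : omap _ _ => h k (to_fibre R n k x)) fg).
  exact: from_to_fibre.
(* The other composite equals the identity, as restricting $1 \otimes c$ to the apex returns [c]. *)
have -> : omap_comp (omap_comp g (to_fibre R n))
    (omap_comp (from_fibre R n) (from_join R n)) = omap_comp g (from_join R n).
  apply: omap_eq => k x /=; congr (g k _).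
  exact: (congr1 (fun h : omap _ _ => h k (from_join R n k x)) (to_from_fibre R n)).
by rewrite gf; apply: rst_refl.
Qed.
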